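(* Let $p$ be a prime number and $t$ be a positive integer. Put $q = p^t$. Let $h \in \mathbb{F}_q[x,y] \setminus \{0\}$. Put $r = \gcd(t, N(h))$. Then the following are equivalent: (i) the polynomial $h$ has no absolutely irreducible factor defined over $\mathbb{F}_q$; (ii) for any positive integer $s$ with $r \mid s$, there exist infinitely many positive integers $n$ such that $V(h)(\mathbb{F}_{q^n}) \subseteq \mathbb{A}^2(\mathbb{F}_{p^s})$; (iii) there exist infinitely many positive integers $n$ such that $V(h)(\mathbb{F}_{q^n}) \subseteq \mathbb{A}^2(\mathbb{F}_{p^r})$; (iv) for some positive integer $s$ with $r \mid s$, there exist infinitely many positive integers $n$ such that $V(h)(\mathbb{F}_{q^n}) \subseteq \mathbb{A}^2(\mathbb{F}_{p^s})$.
   Context: Fix an algebraic closure $\overline{\mathbb{F}_p}$ of $\mathbb{F}_p$; all finite fields $\mathbb{F}_{p^n}$ are regarded as subfields of it. For a subfield $L\subseteq\overline{\mathbb{F}_p}$, $\mathbb{A}^2(L)=L\times L$, and for $g\in\overline{\mathbb{F}_p}[x,y]$, $V(g)(L)=\{(\alpha,\beta)\in\mathbb{A}^2(L)\mid g(\alpha,\beta)=0\}$. For a subfield $K\subseteq\overline{\mathbb{F}_p}$ and $h\in K[x,y]$, $V(h)$ is the closed subscheme of $\mathrm{Spec}\,K[x,y]$ defined by $h$, $V(h)_{\mathrm{red}}$ is its reduction, and $\mathrm{Sing}(V(h)_{\mathrm{red}})$ is the singular locus of $V(h)_{\mathrm{red}}$. Concretely, for $h\neq 0$, if $h_{\mathrm{red}}$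 denotes the product of the distinct (up to scalars) irreducible factors of $h$ in $\overline{\mathbb{F}_p}[x,y]$, then $\mathrm{Sing}(V(h)_{\mathrm{red}})(\overline{\mathbb{F}_p})$ is the set of points of $\mathbb{A}^2(\overline{\mathbb{F}_p})$ at which $h_{\mathrm{red}}$, $\partial h_{\mathrm{red}}/\partial x$ and $\partial h_{\mathrm{red}}/\partial y$ all vanish. Put $$N(h)=\min\{n\in\mathbb{Z}_{>0}\mid \mathrm{Sing}(V(h)_{\mathrm{red}})(\overline{\mathbb{F}_p})\subseteq V(h)(\mathbb{F}_{p^n})\}.$$ An absolutely irreducible factor of $h\in\mathbb{F}_q[x,y]$ defined over $\mathbb{F}_q$ is a polynomial $g\in\mathbb{F}_q[x,y]$ dividing $h$ that is irreducible in $\overline{\mathbb{F}_p}[x,y]$. *)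

(* Defs.v *)
From HB Require Import structures.
From mathcomp Require Import all_boot all_order all_algebra all_field.
From mathcomp Require Import finmap boolp classical_sets functions cardinality.

Set Implicit Arguments.
Unset Strict Implicit.
Unset Printing Implicit Defensive.

Import GRing.Theory.

Local Open Scope card_scope.
Local Open Scope classical_set_scope.
Local Open Scope ring_scope.

(* K[x,y] is {poly {poly K}}, with the conventions of polyXY: the outer       *)
(* variable is x, the inner one is y, and h.[a, b] is the value of h at       *)
(* x = a, y = b.                                                              *)

(* [iota] makes K an algebraic closure of F (K is algebraically closed by its *)
(* type).                                                                     *)
Definition algebraic_closure (F : fieldType) (K : closedFieldType)
    (iota : {rmorphism F -> K}) : Prop :=
  forall z : K, algebraicOver iota z.

(* The subfield with p ^ n elements of an algebraic closure of 'F_p, for      *)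
(* n > 0; see [Fpn_subfield] and [card_Fpn].                                  *)
Definition Fpn (K : fieldType) (p n : nat) : set K :=
  [set z | z ^+ (p ^ n) = z].
Arguments Fpn : clear implicits.

Section PlaneCurves.
Variable K : fieldType.
Implicit Types (L : set K) (f g h : {poly {poly K}}).

Definition A2 L : set (K * K) := L `*` L.

Definition V h L : set (K * K) := A2 L `&` [set P | h.[P.1, P.2] = 0].

Definition defined_over L h : Prop := forall i j : nat, L h`_i`_j.

Definition divides_over L g h : Prop :=
  exists2 k : {poly {poly K}}, defined_over L k & h = k * g.

Definition dx h : {poly {poly K}} := h^`().
Definition dy h : {poly {poly K}} := map_poly deriv h.

(* In K[x,y]; [irreducible_poly] from polydiv compares degrees, so it is only *)
(* appropriate for polynomials in one variable over a field.                  *)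
Definition irreducibleXY g : Prop :=
  [/\ g != 0, g \isn't a GRing.unit &
      forall a b : {poly {poly K}}, g = a * b ->
        a \is a GRing.unit \/ b \is a GRing.unit].

Definition irreducible_factor g h : Prop :=
  irreducibleXY g /\ divides_over setT g h.

Definition eq_up_to_scalar f g : Prop :=
  exists2 c : K, c != 0 & g = c%:P%:P * f.

(* g is h_red, which is only determined up to a nonzero scalar *)
Definition is_red h g : Prop :=
  exists fs : seq {poly {poly K}},
    [/\ forall f, f \in fs -> irreducible_factor f h,
        forall f, irreducible_factor f h ->
          exists2 f', f' \in fs & eq_up_to_scalar f f',
        uniq fs,
        {in fs &, forall f f', eq_up_to_scalar f f' -> f = f'} &
        g = \prod_(f <- fs) f].

Definition Sing_red h : set (K * K) :=
  [set P | exists2 g, is_red h g &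
     [/\ g.[P.1, P.2] = 0, (dx g).[P.1, P.2] = 0 & (dy g).[P.1, P.2] = 0]].

End PlaneCurves.

Definition contains_Sing (K : fieldType) (p : nat) (h : {poly {poly K}}) :
    set nat :=
  [set n | (0 < n)%N /\ Sing_red h `<=` V h (Fpn K p n)].

(* The least element of [contains_Sing p h]; the default value 0 is not       *)
(* reached when K is an algebraic closure of 'F_p and h != 0, since the       *)
(* singular locus is then finite.                                             *)
Definition N (K : fieldType) (p : nat) (h : {poly {poly K}}) : nat :=
  xget 0%N [set n | contains_Sing p h n /\
                    forall m, contains_Sing p h m -> (n <= m)%N].

Section FiniteSubfields.
Variables (p : nat) (K : closedFieldType) (iota : {rmorphism 'F_p -> K}).
Hypothesis p_pr : prime p.

Lemma pcharK : p \in [pchar K].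
Proof. exact: (rmorph_pchar iota (pchar_Fp p_pr)). Qed.

Lemma Fpn_subfield n : divring_closed [pred z : K | `[< Fpn K p n z >]].
Proof.
have E k (z : K) : z ^+ (p ^ k) = iter k (pFrobenius_aut pcharK) z.
  elim: k => [|k IHk] //=; rewrite -IHk pFrobenius_autE.
  by rewrite expnSr exprM.
have EB (x y : K) : (x - y) ^+ (p ^ n) = x ^+ (p ^ n) - y ^+ (p ^ n).
  rewrite !E; elim: n => //= k ->.
  by rewrite rmorphB.
split=> [|x y /asboolP xP /asboolP yP|x y /asboolP xP /asboolP yP];
  apply/asboolP; rewrite /Fpn /=.
- exact: expr1n.
- by rewrite EB xP yP.
- by rewrite exprMn exprVn xP yP.
Qed.

Lemma card_Fpn n : (0 < n)%N -> Fpn K p n #= `I_(p ^ n).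
Proof.
move=> n0; have q1 : (1 < p ^ n)%N.
  by rewrite -{1}(expn0 p) ltn_exp2l ?prime_gt1.
pose P : {poly K} := 'X^(p ^ n) - 'X.
have sP : size P = (p ^ n).+1.
  by rewrite size_polyDl size_polyXn // size_polyN size_polyX ltnS.
have mP : P \is monic.
  by rewrite monicE lead_coefDl ?lead_coefXn // size_polyXn size_polyN
             size_polyX ltnS.
have [rs Prs] := closed_field_poly_normal P.
move: Prs; rewrite (monicP mP) scale1r => Prs.
have Urs : uniq rs.
  rewrite -separable_prod_XsubC -Prs unlock derivB derivXn derivX.
  have -> : 'X^((p ^ n).-1) *+ (p ^ n) = 0 :> {poly K}.
    rewrite -mulr_natr -polyC_natr natrX pcharf0 ?pcharK // expr0n.
    by rewrite eqn0Ngt n0 /= mulr0.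
  by rewrite sub0r -scaleN1r coprimepZr ?oppr_eq0 ?oner_eq0 // coprimep1.
have -> : Fpn K p n = [set` [fset x in rs]%fset].
  apply/seteqP; split => x /=; rewrite !inE.
    move=> /= xP; rewrite -root_prod_XsubC -Prs rootE !hornerE ?hornerXn.
    by rewrite xP subrr.
  rewrite -root_prod_XsubC -Prs rootE !hornerE ?hornerXn subr_eq0.
  by move/eqP.
apply/card_eq_fsetP.
rewrite card_fseq undup_id //.
by apply: succn_inj; rewrite -sP Prs size_prod_XsubC.
Qed.

End FiniteSubfields.

(* Main.v *)
Require Import Defs.
From HB Require Import structures.
From mathcomp Require Import all_boot all_order all_algebra all_field.
From mathcomp Require Import boolp classical_sets functions cardinality.
From mathcomp Require Import finmap zify ring.

Set Implicit Arguments.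
Unset Strict Implicit.
Unset Printing Implicit Defensive.

Import GRing.Theory.

Local Open Scope classical_set_scope.
Local Open Scope ring_scope.

(** Write q = p ^ t and let F_Q be the field with Q elements.  The curve h = 0
    is the union of its irreducible components over the algebraic closure K,
    and the Frobenius map z |-> z ^ q permutes them.

    Suppose that no component is defined over F_q, that is, that Frobenius
    fixes none of them ([normalized_eq], [frobXYP]).  For n congruent to 1
    modulo a suitable L, the Frobenius map of F_(q^n) permutes the components
    as that of F_q does, so a point over F_(q^n) lies on a component and on
    its distinct conjugate, hence is singular on h_red ([points_in_Sing]).
    The singular locus is finite ([Sing_finite]), so N(h) exists and the
    coordinates of such a point are in F_(p^(tn)) and in F_(p^N(h)).  If N(h)
    also divides n - 1, these two fields meet in F_(p^r)
    ([infinitely_many_good]).  This gives (ii), and (ii) -> (iii) -> (iv) is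
    immediate.  Finiteness of the singular locus, and the very existence of
    h_red, rest on unique factorization in K[x,y] ([gauss_factor],
    [irreducible_prime]) and on the perfectness of K ([irreducible_deriv]).

    Suppose now that G is an absolutely irreducible factor of h over F_q.  The
    point is that G has points outside any given finite set over F_(q^n) for
    all large n ([many_points]), which contradicts (iv).  This weak form of
    the Hasse-Weil bound is proved by Stepanov's method, as follows.  One may
    take G separable and monic of degree d in x.  Let Q = q ^ n, and assume
    that above almost all y in F_Q there is no x in F_Q with G(x,y) = 0.  For
    such y and a root x of G(.,y), the conjugate x ^ Q is a root distinct from
    x, hence a root of the polynomial G(Z,y) / (Z - x), whose degree in Z is
    only d - 1.  Write Q = M k with k a power of p that stays fixed while n
    grows, and consider
      Psi = sum of c(i,l) u_i u_l ^ k
    with monomials u_i, u_l of degree < d in x and of degree in y at most m,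
    resp. less than about M (1 - 1/(2d)).  As y ^ Q = y, the value of Psi ^ M at (x,y) is
    the sum of c(i,l) ^ M u_i(x,y) ^ M u_l(x ^ Q,y).  Modulo the relation of
    degree d - 1 satisfied by x ^ Q, its vanishing amounts to a number of
    linear conditions on the c(i,l) ^ M that is smaller than the number of
    unknowns, because this degree is not d ([auxiliary_coefficients],
    [more_unknowns]).  The resulting Psi vanishes at all points of the curve
    above almost all of F_Q, while its degree in y modulo G is less than
    Q (1 - 1/(2d)) plus a constant; therefore G divides Psi
    ([points_monic]).

    On the other hand G cannot divide Psi: the finitely many u_i are linearly
    independent over K in the function field E of the curve, hence over the
    field of k-th powers of E when k is a large enough power of p
    ([frobenius_independence]).  Indeed a family that is dependent over
    each E ^ (p ^ j) is dependent over the intersection of these fields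
    ([dependent_chain]), and that intersection is K
    ([function_field_infinitely_frobenius]). *)

(** * Unique factorization in K[x,y] *)

Section BivariateUFD.
Variable K : closedFieldType.
Implicit Types (f g h A B F : {poly {poly K}}) (c : {poly K}).

Definition dvdXY f h := exists k, h = k * f.

Lemma unitXYP f : reflect (exists2 c : K, c != 0 & f = c%:P%:P) (f \is a GRing.unit).
Proof.
rewrite !poly_unitE; apply: (iffP idP) => [/and3P[sf s0 u0]|[c c0 ->]].
  exists f`_0`_0; first by rewrite -unitfE.
  rewrite [LHS](size1_polyC (eq_leq (eqP sf))).
  by congr _%:P; apply: size1_polyC; rewrite (eqP s0).
by rewrite !coefC !size_polyC polyC_eq0 c0 unitfE.
Qed.

Lemma unitXY_size f : f \is a GRing.unit -> size f = 1%N.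
Proof. by rewrite poly_unitE => /andP[/eqP]. Qed.

Lemma specialize_eq0P (b : K) F :
  map_poly (horner_eval b) F = 0 -> exists F', F = ('X - b%:P) *: F'.
Proof.
move=> F0; exists (\poly_(i < size F) (F`_i %/ ('X - b%:P))).
apply/polyP => i; rewrite coefZ coef_poly.
case: ltnP => [_|szF]; last by rewrite mulr0 nth_default.
rewrite mulrC divpK // dvdp_XsubCl; apply/rootP.
by have := coef_map (horner_eval b) F i; rewrite F0 coef0 => /esym.
Qed.

(** Gauss's lemma: as K is algebraically closed, the factor c of K[y] can be
    removed one linear factor y - b at a time, and the specialization y = b
    takes values in the integral domain K[x], so it kills A or B. *)
Lemma gauss_factor c A B F : c != 0 -> c *: F = A * B ->
  exists c1 c2 A' B', [/\ c1 != 0, c2 != 0, A = c1 *: A', B = c2 *: B' & F = A' * B'].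
Proof.
elim: {c}(size c) {-2}c (erefl (size c)) A B => [|n IHn] c.
  by move/eqP; rewrite size_poly_eq0 => ->.
move=> sc A B c0 E.
have [sc1|/closed_rootP[b /factor_theorem[c' cE]]] := eqVneq (size c) 1%N.
  have cU : c \is a GRing.unit.
    by rewrite poly_unitE sc1 eqxx unitfE -[X in c`_X]/1.-1%N -{1}sc1 -lead_coefE lead_coef_eq0.
  exists c, 1, (c^-1 *: A), B; rewrite scale1r scalerA divrr // scale1r oner_eq0 c0.
  by split=> //; rewrite -scalerAl -E scalerA mulVr // scale1r.
have c'0 : c' != 0 by apply: contraNneq c0 => c'0; rewrite cE c'0 mul0r.
have sc' : size c' = n.
  by move: sc; rewrite cE size_Mmonic ?monicXsubC // size_XsubC addn2 /= => -[].
have X0 : ('X - b%:P)%:P != 0 :> {poly {poly K}} by rewrite polyC_eq0 polyXsubC_eq0.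
have /eqP : map_poly (horner_eval b) A * map_poly (horner_eval b) B = 0.
  rewrite -rmorphM -E; apply/polyP => i; rewrite coef_map coefZ coef0 /=.
  by rewrite /horner_eval hornerM cE hornerM hornerXsubC subrr mulr0 mul0r.
rewrite mulf_eq0 => /orP[]/eqP/specialize_eq0P[G GE].
  have E' : c' *: F = G * B.
    by apply: (mulfI X0); rewrite !mul_polyC scalerA mulrC -cE E GE scalerAl.
  have [c1 [c2 [A' [B' [c10 c20 AE BE FE]]]]] := IHn _ sc' _ _ c'0 E'.
  exists (('X - b%:P) * c1), c2, A', B'.
  split=> //; first by rewrite mulf_neq0 ?polyXsubC_eq0.
  by rewrite GE AE scalerA.
have E' : c' *: F = A * G.
  by apply: (mulfI X0); rewrite !mul_polyC scalerA mulrC -cE E GE scalerAr.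
have [c1 [c2 [A' [B' [c10 c20 AE BE FE]]]]] := IHn _ sc' _ _ c'0 E'.
exists c1, (('X - b%:P) * c2), A', B'.
split=> //; first by rewrite mulf_neq0 ?polyXsubC_eq0.
by rewrite GE BE scalerA.
Qed.

Lemma irreducible_pseudo f c A B : irreducibleXY f -> c != 0 ->
  c *: f = A * B -> size A = 1%N \/ size B = 1%N.
Proof.
move=> [_ _ irr] c0 /(gauss_factor c0)[c1 [c2 [A' [B' [c10 c20 -> -> /irr]]]]].
by rewrite !size_scale // => -[]/unitXY_size; [left|right].
Qed.

(** On polynomials over the domain K[y], [%|] is divisibility in K(y)[x].  By
    Gauss's lemma an irreducible polynomial of positive degree in x is
    primitive, so the quotient has no denominator. *)
Lemma dvdXY_pseudo f a : irreducibleXY f -> (1 < size f)%N -> f %| a -> dvdXY f a.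
Proof.
move=> [f0 _ irr] sf /Pdiv.Idomain.dvdpP[[c q] /= c0 /(gauss_factor c0)].
move=> [c1 [c2 [q' [f' [c10 c20 _ fE ->]]]]].
have := irr c2%:P f'; rewrite mul_polyC => /(_ fE) [|/unitXY_size sf'].
  move=> c2U; exists (q' * (c2%:P)^-1); rewrite fE -mul_polyC mulrA divrK //.
by move: sf; rewrite fE size_scale // sf'.
Qed.

Lemma irreducible_coprimep f a : irreducibleXY f -> (1 < size f)%N ->
  ~~ coprimep f a -> f %| a.
Proof.
move=> irr sf; have f0 : f != 0 by case: irr.
rewrite coprimep_def => sg.
have /Pdiv.Idomain.dvdpP[[c q] /= c0 E] := dvdp_gcdl f a.
have [/eqP/size_poly1P[e e0 qE]|/eqP] := irreducible_pseudo irr c0 E; last first.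
  by rewrite (negPf sg).
apply: dvdp_trans (dvdp_gcdr f a); apply/Pdiv.Idomain.dvdpP.
by exists (e, c%:P) => //=; rewrite mul_polyC E qE mul_polyC.
Qed.

(** As K is algebraically closed, an irreducible polynomial in y alone is
    linear. *)
Lemma irreducible_inner f : irreducibleXY f -> (size f <= 1)%N ->
  exists2 b : K, dvdXY f ('X - b%:P)%:P & dvdXY ('X - b%:P)%:P f.
Proof.
move=> [f0 fnU irr] /size1_polyC fE.
have [sf|/closed_rootP[b /factor_theorem[c cE]]] := eqVneq (size f`_0) 1%N.
  case/negP: fnU; apply/unitXYP; exists f`_0`_0; last first.
    by rewrite {1}fE {1}(@size1_polyC _ f`_0) // sf.
  apply: contraNneq f0 => E; rewrite fE (@size1_polyC _ f`_0) ?sf //.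
  by rewrite E.
exists b; last by exists c%:P; rewrite -polyCM -cE.
have := irr c%:P ('X - b%:P)%:P; rewrite -polyCM -cE => /(_ fE)[cU|].
  by exists (c%:P)^-1; rewrite fE cE polyCM mulKr.
by rewrite poly_unitE coefC poly_unitE size_XsubC andbF.
Qed.

(** For f of positive degree in x this is Euclid's lemma in K(y)[x]; otherwise
    f is associate to some y - b, and K[x,y] / (y - b) = K[x] is a domain. *)
Lemma irreducible_prime f a b : irreducibleXY f -> dvdXY f (a * b) ->
  dvdXY f a \/ dvdXY f b.
Proof.
move=> irr [k E]; have [sf|sf] := leqP (size f) 1.
  have [r [k1 E1] [k2 E2]] := irreducible_inner irr sf.
  have /eqP : map_poly (horner_eval r) a * map_poly (horner_eval r) b = 0.
    have X0 : map_poly (horner_eval r) ('X - r%:P)%:P = 0.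
      by rewrite map_polyC /= /horner_eval hornerXsubC subrr polyC0.
    by rewrite -rmorphM E E2 !rmorphM [X in _ * (_ * X)]X0 !mulr0.
  rewrite mulf_eq0 => /orP[]/eqP/specialize_eq0P[G ->]; [left|right];
    by exists (G * k1); rewrite -mulrA -E1 -mul_polyC mulrC.
have [cop|/(irreducible_coprimep irr sf)] := boolP (coprimep f a).
  right; apply: dvdXY_pseudo => //; rewrite -(Gauss_dvdpr _ cop).
  by apply/Pdiv.Idomain.dvdpP; exists (1, k); rewrite ?oner_eq0 // scale1r.
by left; apply: dvdXY_pseudo.
Qed.

(** The polynomial rho is a Bezout constant of f and a in K(y)[x], cleared of
    denominators. *)
Lemma common_zeros_inner f a : irreducibleXY f -> ~ dvdXY f a ->
  exists2 rho : {poly K}, rho != 0 &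
    forall x y, f.[x, y] = 0 -> a.[x, y] = 0 -> rho.[y] = 0.
Proof.
move=> irr nd; have [sf|sf] := leqP (size f) 1.
  exists f`_0 => [|x y].
    by case: irr => f0 _ _; apply: contraNneq f0 => E; rewrite (size1_polyC sf) E.
  by rewrite {1}(size1_polyC sf) hornerC.
have cop : coprimep f a.
  by apply: contrapT => /negP/(irreducible_coprimep irr sf)/(dvdXY_pseudo irr sf).
have [[u v] /= /eqpP[[c1 c2] /= /andP[c10 c20] E]] := Bezoutp f a.
move: cop; rewrite coprimep_def => /eqP sg.
have gE := @size1_polyC _ (gcdp f a); move: gE; rewrite sg => /(_ isT) gE.
exists (c2 * (gcdp f a)`_0) => [|x y fxy axy].
  rewrite mulf_neq0 //; apply: contra_eqN sg => /eqP g0.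
  by rewrite gE g0 size_poly0.
transitivity ((c2 *: gcdp f a).[x, y]); first by rewrite gE hornerZ hornerC coefC.
by rewrite -E hornerZ hornerD !hornerM hornerD !hornerM fxy axy !mulr0 addr0 mulr0.
Qed.

End BivariateUFD.

(** * Irreducible components and singular points *)

Section Factorization.
Variable K : closedFieldType.
Implicit Types (f g h k : {poly {poly K}}).

(** A degree in both variables together, for induction on factorizations: it
    is additive up to a shift and detects units. *)
Definition bisize f := (size f + size (swapXY f))%N.

Lemma swapXY_neq0 f : f != 0 -> swapXY f != 0.
Proof. by apply: contraNneq => E; rewrite -[f]swapXYK E rmorph0. Qed.

Lemma bisize_unit f : f != 0 -> (bisize f <= 2)%N -> f \is a GRing.unit.
Proof.
move=> f0; have sf0 := swapXY_neq0 f0.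
rewrite /bisize => le2.
have [e1 e2] : size f = 1%N /\ sizeY f = 1%N.
  rewrite sizeYE; move: f0 sf0 le2; rewrite -!size_poly_gt0.
  by case: size => [|[|n]] //; case: size => [|[|m]] //; rewrite ?addnS ?addSn.
have [c c0 fE] := size_poly1P _ (introT eqP e1).
have := max_size_coefXY f 0; rewrite e2 fE coefC /= => /size1_polyC cE.
apply/unitXYP; exists c`_0; last by rewrite -cE.
by apply: contraNneq c0 => E; rewrite cE E.
Qed.

Lemma bisize_mul f g : f != 0 -> g != 0 ->
  (bisize (f * g) + 2 = bisize f + bisize g)%N.
Proof.
move=> f0 g0; have [sf0 sg0] := (swapXY_neq0 f0, swapXY_neq0 g0).
have arith (a b c d : nat) : (0 < a -> 0 < b -> 0 < c -> 0 < d ->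
    (a + b).-1 + (c + d).-1 + 2 = a + c + (b + d))%N by lia.
by rewrite /bisize rmorphM !size_mul //; apply: arith; rewrite size_poly_gt0.
Qed.

Lemma irreducible_factorization h : h != 0 ->
  exists u (fs : seq {poly {poly K}}),
    [/\ u \is a GRing.unit, {in fs, forall f, irreducibleXY f} & h = u * \prod_(f <- fs) f].
Proof.
elim: {h}(bisize h) {-2}h (leqnn (bisize h)) => [|n IHn] h hn h0.
  by move: hn h0; rewrite leqn0 addn_eq0 size_poly_eq0 => /andP[->].
have [hU|hnU] := boolP (h \is a GRing.unit).
  by exists h, [::]; rewrite big_nil mulr1.
have [irr|nirr] := pselect (irreducibleXY h).
  exists 1, [:: h]; rewrite big_seq1 mul1r rpred1; split=> // f.
  by rewrite inE => /eqP ->.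
have [a [b [hE aN bN]]] : exists a b, [/\ h = a * b, a \isn't a GRing.unit &
    b \isn't a GRing.unit].
  apply: contrapT => nab; apply: nirr; split=> // a b hE.
  have [aU|aN] := boolP (a \is a GRing.unit); first by left.
  have [bU|bN] := boolP (b \is a GRing.unit); first by right.
  by case: nab; exists a, b.
have a0 : a != 0 by apply: contraNneq h0 => E; rewrite hE E mul0r.
have b0 : b != 0 by apply: contraNneq h0 => E; rewrite hE E mulr0.
have := bisize_mul a0 b0; rewrite -hE => S.
have sa : (2 < bisize a)%N by rewrite ltnNge; apply: contra aN; apply: bisize_unit.
have sb : (2 < bisize b)%N by rewrite ltnNge; apply: contra bN; apply: bisize_unit.
have [||ua [fa [uaU irra aE]]] := IHn a => //; first lia.
have [||ub [fb [ubU irrb bE]]] := IHn b => //; first lia.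
exists (ua * ub), (fa ++ fb); rewrite big_cat /= mulrACA -aE -bE unitrM uaU ubU.
by split=> // f; rewrite mem_cat => /orP[/irra|/irrb].
Qed.

Lemma scalar_refl f : eq_up_to_scalar f f.
Proof. by exists 1; rewrite ?oner_eq0 // polyC1 mul1r. Qed.

Lemma scalar_sym f g : eq_up_to_scalar f g -> eq_up_to_scalar g f.
Proof.
move=> [c c0 ->]; exists c^-1; first by rewrite invr_eq0.
by rewrite mulrA -!polyCM mulVf // polyC1 mul1r.
Qed.

Lemma scalar_trans g f h :
  eq_up_to_scalar f g -> eq_up_to_scalar g h -> eq_up_to_scalar f h.
Proof.
move=> [c c0 ->] [d d0 ->]; exists (d * c); first by rewrite mulf_neq0.
by rewrite mulrA -!polyCM.
Qed.

Lemma scalar_zero f g x y : eq_up_to_scalar f g -> f.[x, y] = 0 -> g.[x, y] = 0.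
Proof. by move=> [c _ ->] E; rewrite hornerM hornerM E mulr0. Qed.

Lemma irreducible_dvd_scalar f g : irreducibleXY f -> irreducibleXY g ->
  dvdXY f g -> eq_up_to_scalar f g.
Proof.
move=> [_ fN _] [_ _ irr] [k E]; have [/unitXYP[c c0 kE]|] := irr _ _ E.
  by exists c; rewrite // E kE.
by rewrite (negPf fN).
Qed.

Lemma divides_setT f g : divides_over setT f g <-> dvdXY f g.
Proof. by split=> [[k _ E]|[k E]]; exists k. Qed.

Lemma irreducible_dvd_prod f (fs : seq {poly {poly K}}) : irreducibleXY f ->
  dvdXY f (\prod_(g <- fs) g) -> exists2 g, g \in fs & dvdXY f g.
Proof.
move=> irr; have [_ fN _] := irr; elim: fs => [|g fs IHfs].
  rewrite big_nil => -[k /(congr1 (fun x => x \is a GRing.unit))].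
  by rewrite rpred1 unitrM (negPf fN) andbF.
rewrite big_cons => /(irreducible_prime irr)[|/IHfs[g' g'in d]].
  by exists g; rewrite ?mem_head.
by exists g'; rewrite // inE g'in orbT.
Qed.

Lemma scalar_representatives (fs : seq {poly {poly K}}) :
  exists fs' : seq {poly {poly K}},
    [/\ {subset fs' <= fs}, forall f, f \in fs -> exists2 f', f' \in fs' & eq_up_to_scalar f f',
        uniq fs' & {in fs' &, forall f f', eq_up_to_scalar f f' -> f = f'}].
Proof.
elim: fs => [|f fs [fs' [sub rep Ufs dist]]]; first by exists [::].
have [[f' f'in ff']|nrep] := pselect (exists2 f', f' \in fs' & eq_up_to_scalar f f').
  exists fs'; split=> // g; first by move/sub; rewrite inE orbC => ->.
  by rewrite inE => /orP[/eqP->|/rep//]; exists f'.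
exists (f :: fs'); split=> [g|g||].
- by rewrite !inE => /orP[->//|/sub ->]; rewrite orbT.
- rewrite inE => /orP[/eqP->|/rep[g' g'in gg']].
    by exists f; [rewrite mem_head|exact: scalar_refl].
  by exists g'; rewrite // inE g'in orbT.
- rewrite /= Ufs andbT; apply/negP => fin; apply: nrep.
  by exists f => //; exact: scalar_refl.
- move=> g g'; rewrite !inE => /orP[/eqP->|gin] /orP[/eqP->|g'in] // E.
  + by case: nrep; exists g'.
  + by case: nrep; exists g => //; apply: scalar_sym.
  + exact: dist.
Qed.

(** Irreducible elements being prime, every irreducible factor of h is one of
    those of a given factorization, up to scalars; hence h_red exists. *)
Lemma irreducible_factors_list h : h != 0 -> exists fs : seq {poly {poly K}},
    [/\ forall f, f \in fs -> irreducible_factor f h,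
        forall f, irreducible_factor f h ->
          exists2 f', f' \in fs & eq_up_to_scalar f f',
        uniq fs &
        {in fs &, forall f f', eq_up_to_scalar f f' -> f = f'}].
Proof.
move=> h0; have [u [fs [uU irr hE]]] := irreducible_factorization h0.
have [fs' [sub rep Ufs dist]] := scalar_representatives fs.
exists fs'; split=> // f.
  move/sub => fin; split; first exact: irr.
  apply/divides_setT; rewrite hE (perm_big _ (perm_to_rem fin)) big_cons /=.
  by exists (u * \prod_(g <- rem f fs) g); rewrite mulrCA mulrC.
move=> [irrf /divides_setT]; rewrite hE => /(irreducible_prime irrf)[[k E]|].
  by case: irrf => _ /negPf fN _; move: uU; rewrite E unitrM fN andbF.
move=> /(irreducible_dvd_prod irrf)[g gin fg].
have [f' f'in gf'] := rep _ gin; exists f' => //.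
apply: scalar_trans gf'; apply: irreducible_dvd_scalar fg => //; exact: irr.
Qed.

Lemma zero_on_factor h x y : h != 0 -> h.[x, y] = 0 ->
  exists2 f, irreducible_factor f h & f.[x, y] = 0.
Proof.
move=> h0; have [u [fs [/unitXYP[c c0 uE] irr hE]]] := irreducible_factorization h0.
rewrite {1}hE uE !hornerM !hornerC => /eqP; rewrite mulf_eq0 (negPf c0) /=.
move=> E; have [f fin f0] : exists2 f, f \in fs & f.[x, y] = 0.
  elim: fs {irr hE} E => [|f fs IHfs]; first by rewrite big_nil !hornerC oner_eq0.
  rewrite big_cons !hornerM mulf_eq0 => /orP[/eqP|/IHfs[g gin g0]].
    by exists f; rewrite ?mem_head.
  by exists g; rewrite // inE gin orbT.
exists f => //; split; first exact: irr.
apply/divides_setT; rewrite hE (perm_big _ (perm_to_rem fin)) big_cons /=.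
by exists (u * \prod_(g <- rem f fs) g); rewrite mulrCA mulrC.
Qed.

Lemma dx_mul f g : dx (f * g) = dx f * g + f * dx g.
Proof. exact: derivM. Qed.

Lemma dy_mul f g : dy (f * g) = dy f * g + f * dy g.
Proof.
rewrite /dy; apply/polyP => i; rewrite coefD coef_map /= !coefM raddf_sum -big_split /=.
by apply: eq_bigr => j _; rewrite derivM !coef_map.
Qed.

(** By the product rule, each term of h_red and of its partial derivatives
    keeps one of the two factors f and g. *)
Lemma two_components_Sing h f g x y : h != 0 ->
  irreducible_factor f h -> irreducible_factor g h -> ~ eq_up_to_scalar f g ->
  f.[x, y] = 0 -> g.[x, y] = 0 -> Sing_red h (x, y).
Proof.
move=> h0 ff fg nfg f0 g0.
have [fs [P1 P2 P3 P4]] := irreducible_factors_list h0.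
have [f' f'in sf] := P2 _ ff; have [g' g'in sg] := P2 _ fg.
exists (\prod_(f <- fs) f); first by exists fs.
rewrite (perm_big _ (perm_to_rem f'in)) big_cons /=.
have g'in2 : g' \in rem f' fs.
  rewrite mem_rem_uniq // inE g'in andbT; apply/eqP => E; apply: nfg.
  by apply: scalar_trans sf _; rewrite -E; apply: scalar_sym.
rewrite (perm_big _ (perm_to_rem g'in2)) big_cons /=.
have f'0 := scalar_zero sf f0; have g'0 := scalar_zero sg g0.
by rewrite !(dx_mul, dy_mul) !(hornerM, hornerD) f'0 g'0 !(mul0r, mulr0, addr0).
Qed.

(** Let f be a factor through the point and k the product of the others.  If k
    does not vanish there, the gradient of h_red = f k is k times that of f. *)
Lemma Sing_cases h (fs : seq {poly {poly K}}) x y :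
  (forall f, irreducible_factor f h -> exists2 f', f' \in fs & eq_up_to_scalar f f') ->
  Sing_red h (x, y) ->
  (exists f g, [/\ f \in fs, g \in fs, ~ eq_up_to_scalar f g, f.[x, y] = 0 & g.[x, y] = 0])
  \/ (exists f, [/\ f \in fs, f.[x, y] = 0, (dx f).[x, y] = 0 & (dy f).[x, y] = 0]).
Proof.
move=> rep [_ [gs [P1 P2 P3 P4 ->]] /= [E Ex Ey]].
have [f fin f0] : exists2 f, f \in gs & f.[x, y] = 0.
  elim: gs {P1 P2 P3 P4 Ex Ey} E => [|f gs IHgs].
    by rewrite big_nil !hornerC => /eqP; rewrite oner_eq0.
  rewrite big_cons !hornerM => /eqP; rewrite mulf_eq0 => /orP[/eqP|/eqP/IHgs[g gin g0]].
    by exists f; rewrite ?mem_head.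
  by exists g; rewrite // inE gin orbT.
have [f' f'in [c c0 f'E]] := rep _ (P1 _ fin).
have f'0 : f'.[x, y] = 0 by rewrite f'E !hornerM f0 mulr0.
move: E Ex Ey; rewrite (perm_big _ (perm_to_rem fin)) big_cons /= dx_mul dy_mul.
rewrite !(hornerM, hornerD) f0 !mul0r !addr0 => _ /eqP Ex /eqP Ey.
set k := \prod_(g <- rem f gs) g in Ex Ey.
have [k0|kN0] := eqVneq k.[x, y] 0.
  left.
  have [g gin g0] : exists2 g, g \in rem f gs & g.[x, y] = 0.
    move: k0; rewrite /k; elim: (rem f gs) => [|e s IHs].
      by rewrite big_nil !hornerC => /eqP; rewrite oner_eq0.
    rewrite big_cons !hornerM => /eqP; rewrite mulf_eq0 => /orP[/eqP|/eqP/IHs[g gin g0]].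
      by exists e; rewrite ?mem_head.
    by exists g; rewrite // inE gin orbT.
  move: gin; rewrite mem_rem_uniq // inE => /andP[/eqP gf gin].
  have [g' g'in sg] := rep _ (P1 _ gin).
  exists f', g'; split=> //; last exact: scalar_zero sg g0.
  move=> fg; apply: gf; apply: P4 => //; apply: scalar_trans sg _.
  by apply: scalar_sym; apply: scalar_trans fg; exists c.
right; exists f'; split=> //.
  move: Ex; rewrite mulf_eq0 (negPf kN0) orbF => /eqP Ex.
  by rewrite f'E dx_mul !(hornerM, hornerD) Ex f0 !mulr0 addr0.
move: Ey; rewrite mulf_eq0 (negPf kN0) orbF => /eqP Ey.
by rewrite f'E dy_mul !(hornerM, hornerD) Ey f0 !mulr0 addr0.
Qed.

End Factorization.

(** * Powers of Frobenius and separability *)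

Section FrobeniusPower.
Variables (p : nat) (R : comNzRingType) (chR : p \in [pchar R]) (n : nat).

(** The proof that R has characteristic p is an argument so that the ring
    morphism structure can be inferred. *)
Definition frob of p \in [pchar R] := fun z : R => z ^+ (p ^ n).

Lemma pchar_nat_exp : [pchar R].-nat (p ^ n)%N.
Proof.
rewrite (eq_pnat _ (pcharf_eq chR)) pnatX.
by rewrite pnat_id // (pcharf_prime chR).
Qed.

Lemma frob_zmod : zmod_morphism (frob chR).
Proof. by move=> x y; rewrite /frob exprDn_pchar ?exprNn_pchar ?pchar_nat_exp. Qed.

Lemma frob_monoid : monoid_morphism (frob chR).
Proof. by split=> [|x y]; rewrite /frob ?expr1n ?exprMn. Qed.

HB.instance Definition _ := GRing.isZmodMorphism.Build R R (frob chR) frob_zmod.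
HB.instance Definition _ := GRing.isMonoidMorphism.Build R R (frob chR) frob_monoid.

End FrobeniusPower.

Lemma frob_inj p (R : idomainType) (chR : p \in [pchar R]) n : injective (frob n chR).
Proof.
move=> x y /eqP; rewrite -subr_eq0 -rmorphB /frob /= expf_eq0 => /andP[_].
by rewrite subr_eq0 => /eqP.
Qed.

Lemma frob_surj p (K : closedFieldType) (chK : p \in [pchar K]) n (z : K) :
  exists x, frob n chK x = z.
Proof.
have pn0 : (0 < p ^ n)%N by rewrite expn_gt0 prime_gt0 // (pcharf_prime chK).
have /closed_rootP[x] : size ('X^(p ^ n) - z%:P : {poly K}) != 1%N.
  by rewrite size_XnsubC // eqSS -lt0n.
by rewrite rootE !hornerE subr_eq0 => /eqP; exists x.
Qed.

Lemma frob_sum p (R : comNzRingType) (chR : p \in [pchar R]) n I (r : seq I) (P : pred I)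
    (F : I -> R) : (\sum_(i <- r | P i) F i) ^+ (p ^ n) = \sum_(i <- r | P i) F i ^+ (p ^ n).
Proof. exact: (rmorph_sum (frob n chR)). Qed.

(** Only the exponents divisible by p survive in q, so that the p-th roots of
    its coefficients are the coefficients of a p-th root of q. *)
Lemma pth_power p (R : idomainType) (chR : p \in [pchar R]) (q : {poly R}) :
  q^`() = 0 -> (forall i, exists r, q`_i = r ^+ p) -> exists s, q = s ^+ p.
Proof.
move=> q'0 /choice[r qE]; exists (\poly_(i < size q) r (i * p)%N).
have p0 := prime_gt0 (pcharf_prime chR).
have chP : p \in [pchar {poly R}] by rewrite pchar_poly.
rewrite poly_def -[in RHS](expn1 p) (frob_sum chP) expn1.
apply/polyP => k; rewrite coef_sum.
under eq_bigr do rewrite exprZn -exprM coefZ coefXn -qE.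
have [/dvdnP[j ->]|kNp] := boolP (p %| k)%N; last first.
  rewrite big1 => [|i _]; last first.
    by rewrite (_ : (k == _) = false) ?mulr0 //; apply: contraNF kNp => /eqP->; apply: dvdn_mull.
  case: k kNp => [|k]; first by rewrite dvdn0.
  rewrite (dvdn_pcharf chR) => kN0; have := coef_deriv q k.
  by rewrite q'0 coef0 -mulr_natr => /esym/eqP; rewrite mulf_eq0 (negPf kN0) orbF => /eqP.
have [szj|ltj] := leqP (size q) j.
  rewrite big1 ?nth_default //; first by apply: leq_trans szj _; rewrite leq_pmulr.
  move=> [i /= lti] _; rewrite eqn_pmul2r // (_ : (j == i) = false) ?mulr0 //.
  by apply/eqP => E; move: lti; rewrite -E ltnNge szj.
rewrite (bigD1 (Ordinal ltj)) //= eqxx mulr1 big1 ?addr0 // => i.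
rewrite -val_eqE /= eqn_pmul2r // eq_sym => /negPf ->; exact: mulr0.
Qed.

Section Separability.
Variables (p : nat) (K : closedFieldType) (chK : p \in [pchar K]).
Implicit Types (f g h : {poly {poly K}}).

(** K is perfect, so a polynomial with both partial derivatives zero is a p-th
    power: first its coefficients are p-th powers in K[y], then so is itself. *)
Lemma irreducible_deriv f : irreducibleXY f -> dx f != 0 \/ dy f != 0.
Proof.
move=> [f0 fN irr]; have [dx0|] := eqVneq (dx f) 0; last by left.
right; apply/eqP => dy0; have p1 := prime_gt1 (pcharf_prime chK).
have chP : p \in [pchar {poly K}] by rewrite pchar_poly.
have [|s fE] := pth_power chP dx0.
  move=> i; apply: (pth_power chK) => [|j].
    by have := coef_map (@deriv K) f i; rewrite [map_poly _ _]dy0 coef0.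
  by have [r E] := frob_surj chK 1 f`_i`_j; exists r; rewrite -E /frob expn1.
have sN : s \isn't a GRing.unit by apply: contra fN => sU; rewrite fE rpredX.
have : s ^+ p = s * s ^+ p.-1 by rewrite -exprS prednK // ltnW.
rewrite -fE => /irr[|]; first by rewrite (negPf sN).
by rewrite unitrX_pos ?(negPf sN) // -ltnS prednK // ltnW.
Qed.

Lemma swapXY_dy f : swapXY (dy f) = dx (swapXY f).
Proof.
apply/polyP => i; apply/polyP => j; rewrite coef_swapXY coef_map /= !coef_deriv.
by rewrite coefMn !coef_swapXY.
Qed.

Lemma swapXY_unit f : f \is a GRing.unit -> swapXY f \is a GRing.unit.
Proof. exact: rmorph_unit. Qed.

Lemma swapXY_irreducible f : irreducibleXY f -> irreducibleXY (swapXY f).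
Proof.
move=> [f0 fN irr]; split=> [||a b E]; first exact: swapXY_neq0.
  by apply: contra fN => U; rewrite -[f]swapXYK; apply: swapXY_unit.
have fE : f = swapXY a * swapXY b by rewrite -[f]swapXYK E; apply: rmorphM.
have := irr _ _ fE.
by case=> U; [left; rewrite -[a]swapXYK|right; rewrite -[b]swapXYK]; apply: swapXY_unit.
Qed.

Lemma dvdXY_swap f g : dvdXY f g -> dvdXY (swapXY f) (swapXY g).
Proof. by move=> [k ->]; exists (swapXY k); rewrite rmorphM. Qed.

Lemma dvdXY_size f g : g != 0 -> dvdXY f g -> (size f <= size g)%N.
Proof.
move=> g0 [k E]; have k0 : k != 0 by apply: contraNneq g0 => k0; rewrite E k0 mul0r.
have f0 : f != 0 by apply: contraNneq g0 => f0; rewrite E f0 mulr0.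
by rewrite E size_mul // -subn1 leq_subRL ?addn_gt0 ?size_poly_gt0 ?k0 // leq_add2r size_poly_gt0.
Qed.

(** A nonzero partial derivative has smaller degree in the corresponding
    variable than f. *)
Lemma not_dvdXY_deriv f : irreducibleXY f -> ~ dvdXY f (dx f) \/ ~ dvdXY f (dy f).
Proof.
have aux g : g != 0 -> dx g != 0 -> ~ dvdXY g (dx g).
  by move=> g0 dg0 /(dvdXY_size dg0); rewrite leqNgt lt_size_deriv.
move=> irr; have f0 : f != 0 by case: irr.
have [dx0|dy0] := irreducible_deriv irr; [left|right]; first exact: aux.
move/dvdXY_swap; rewrite swapXY_dy; apply: aux; first exact: swapXY_neq0.
by rewrite -swapXY_dy; apply: swapXY_neq0.
Qed.

Lemma roots_seq (rho : {poly K}) : rho != 0 ->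
  exists s : seq K, forall z, rho.[z] = 0 -> z \in s.
Proof.
move=> rho0; have [s E] := closed_field_poly_normal rho; exists s => z.
rewrite E hornerZ => /eqP; rewrite mulf_eq0 lead_coef_eq0 (negPf rho0) /=.
by rewrite -[_ == 0]/(root _ _) root_prod_XsubC.
Qed.

Lemma common_zeros_finite f a : irreducibleXY f -> ~ dvdXY f a ->
  exists s : seq K, forall x y, f.[x, y] = 0 -> a.[x, y] = 0 -> x \in s /\ y \in s.
Proof.
move=> irr nd; have [rho /roots_seq[s sP] H] := common_zeros_inner irr nd.
have [|rho' /roots_seq[s' s'P] H'] := common_zeros_inner (a := swapXY a) (swapXY_irreducible irr).
  by move/dvdXY_swap; rewrite !swapXYK.
exists (s ++ s') => x y fxy axy; rewrite !mem_cat (sP y) ?(s'P x) ?orbT //.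
  by apply: (H' y); rewrite horner2_swapXY.
exact: (H x).
Qed.

Lemma seq_bound (T U : eqType) (l : seq T) (Q : T -> U -> Prop) :
  (forall i, i \in l -> exists s : seq U, forall z, Q i z -> z \in s) ->
  exists s : seq U, forall i z, i \in l -> Q i z -> z \in s.
Proof.
elim: l => [|i l IHl] H; first by exists [::].
have [|s sP] := IHl; first by move=> j jl; apply: H; rewrite inE jl orbT.
have [s' s'P] := H i (mem_head _ _).
exists (s ++ s') => j z; rewrite inE mem_cat => /orP[/eqP->/s'P->|jl /(sP _ _ jl)->//].
by rewrite orbT.
Qed.

Lemma Sing_finite h : h != 0 ->
  exists s : seq K, forall x y, Sing_red h (x, y) -> x \in s /\ y \in s.
Proof.
move=> h0; have [fs [P1 P2 _ _]] := irreducible_factors_list h0.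
pose Q1 (fg : {poly {poly K}} * {poly {poly K}}) (z : K) := ~ eq_up_to_scalar fg.1 fg.2 /\
  exists x y, [/\ fg.1.[x, y] = 0, fg.2.[x, y] = 0 & z = x \/ z = y].
pose Q2 f (z : K) := exists x y,
  [/\ f.[x, y] = 0, (dx f).[x, y] = 0, (dy f).[x, y] = 0 & z = x \/ z = y].
have [|s1 s1P] := @seq_bound _ _ [seq (f, g) | f <- fs, g <- fs] Q1.
  move=> _ /allpairsP[[f g] /= [fin gin ->]].
  have [sc|nsc] := pselect (eq_up_to_scalar f g); first by exists [::] => z [].
  have [[irf _] [irg _]] := (P1 _ fin, P1 _ gin).
  have [|s sP] := common_zeros_finite (a := g) irf; first by move/(irreducible_dvd_scalar irf irg).
  by exists s => z [_ [x [y [/= fz gz [->|->]]]]]; case: (sP x y fz gz).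
have [|s2 s2P] := @seq_bound _ _ fs Q2.
  move=> f fin; have [irf _] := P1 _ fin.
  have [/(common_zeros_finite irf)[s sP]|/(common_zeros_finite irf)[s sP]] := not_dvdXY_deriv irf.
    by exists s => z [x [y [fz dxz dyz [->|->]]]]; case: (sP x y fz dxz).
  by exists s => z [x [y [fz dxz dyz [->|->]]]]; case: (sP x y fz dyz).
exists (s1 ++ s2) => x y /(Sing_cases P2)[[f [g [fin gin nsc fz gz]]]|[f [fin fz dxz dyz]]].
  have fgin : (f, g) \in [seq (f, g) | f <- fs, g <- fs] by apply/allpairsP; exists (f, g).
  rewrite !mem_cat (s1P (f, g) x) ?(s1P (f, g) y) //; split=> //; exists x, y; split=> //.
    by right.
  by left.
rewrite !mem_cat (s2P f x) ?(s2P f y) ?orbT //; exists x, y; split=> //; first by right.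
by left.
Qed.

End Separability.

(** * Finite subfields of K *)

Section FiniteFields.
Variables (p : nat) (K : closedFieldType) (chK : p \in [pchar K]).
Implicit Types (f g h : {poly {poly K}}).

Lemma Fpn_dvd m n : (m %| n)%N -> Fpn K p m `<=` Fpn K p n.
Proof.
rewrite /Fpn => /dvdnP[k ->] z /= zm; elim: k => [|k IHk]; first by rewrite mul0n expn0 expr1.
by rewrite mulSn expnD exprM zm.
Qed.

(** By Bezout, if u m = v n + gcd m n, then applying Frobenius gcd m n times to
    a common fixed point amounts to applying it u m times. *)
Lemma Fpn_gcd m n : (0 < m)%N -> Fpn K p m `&` Fpn K p n `<=` Fpn K p (gcdn m n).
Proof.
move=> m0 z [zm zn]; have [u v E _] := egcdnP n m0.
have := Fpn_dvd (dvdn_mull u (dvdnn m)) zm; rewrite /Fpn /= E expnD exprM.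
by rewrite (Fpn_dvd (dvdn_mull v (dvdnn n)) zn).
Qed.

Lemma Fpn_common (s : seq K) :
  (forall z, z \in s -> exists2 n, (0 < n)%N & Fpn K p n z) ->
  exists2 n, (0 < n)%N & forall z, z \in s -> Fpn K p n z.
Proof.
elim: s => [|a s IHs] H; first by exists 1%N.
have [|n n0 nP] := IHs; first by move=> z zs; apply: H; rewrite inE zs orbT.
have [m m0 mP] := H a (mem_head _ _).
exists (m * n)%N; first by rewrite muln_gt0 m0.
move=> z; rewrite inE => /orP[/eqP->|/nP]; last exact: Fpn_dvd (dvdn_mull _ (dvdnn _)) _.
exact: Fpn_dvd (dvdn_mulr _ (dvdnn _)) _ mP.
Qed.

(** The iterated Frobenius images of an algebraic element are roots of one
    polynomial over F_p, so two of them coincide. *)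
Lemma algebraic_in_Fpn (iota : {rmorphism 'F_p -> K}) (z : K) :
  algebraicOver iota z -> exists2 n, (0 < n)%N & Fpn K p n z.
Proof.
have p_pr := pcharf_prime chK.
move=> [P P0 /rootP Pz].
have rt i : root (map_poly iota P) (z ^+ (p ^ i)).
  apply/rootP; rewrite -[LHS]/(_.[frob i chK z]).
  have -> : map_poly iota P = map_poly (frob i chK) (map_poly iota P).
    apply/polyP => j; rewrite !coef_map /= /frob -rmorphXn /=; congr (iota _).
    elim: i => [|i IHi]; first by rewrite expn0 expr1.
    by rewrite expnSr exprM -IHi -[X in _ ^+ X](card_Fp p_pr) expf_card.
  by rewrite horner_map Pz rmorph0.
have P'0 : map_poly iota P != 0 by rewrite map_poly_eq0.
have [s sP] := roots_seq P'0.
have : ~~ uniq (mkseq (fun i => z ^+ (p ^ i)) (size s).+1).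
  apply/negP => U; have: {subset mkseq (fun i => z ^+ (p ^ i)) (size s).+1 <= s}.
    by move=> _ /mapP[i _ ->]; apply: sP; apply/rootP.
  by move/(uniq_leq_size U); rewrite size_mkseq ltnn.
move/(uniqPn 0) => [i [j [ij]]]; rewrite size_mkseq => js.
rewrite !nth_mkseq // ?(ltn_trans ij) // => E.
exists (j - i)%N; first by rewrite subn_gt0.
apply: (frob_inj (n := i) (chR := chK)); rewrite /frob -exprM -expnD subnK ?E //.
exact: ltnW.
Qed.

End FiniteFields.

(** * Curves without absolutely irreducible components over the base field *)

Lemma infinite_natP (A : set nat) : infinite_set A <-> forall m, exists2 n, (m <= n)%N & A n.
Proof.
split=> [infA m|unb /finite_seqP[l AE]].
  apply: contrapT => nex; apply: infA; apply: sub_finite_set (finite_II m) => n An /=.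
  by rewrite ltnNge; apply/negP => mn; apply: nex; exists n.
have [n] := unb (\max_(i <- l) i).+1; rewrite AE /= => lt nl.
by move: lt; rewrite ltnNge (big_rem n nl) leq_maxl.
Qed.

Section FrobeniusOnCurves.
Variables (p : nat) (K : closedFieldType) (chK : p \in [pchar K]).
Hypothesis K_alg : forall z : K, exists2 n, (0 < n)%N & Fpn K p n z.
Implicit Types (f g h : {poly {poly K}}).

Lemma factor_zero f h x y : irreducible_factor f h -> f.[x, y] = 0 -> h.[x, y] = 0.
Proof. by move=> [_ [k _ ->]] f0; rewrite !hornerM f0 mulr0. Qed.

(** The singular locus is finite and its points have algebraic coordinates, so
    the minimum defining N h is over a nonempty set. *)
Lemma N_spec h : h != 0 ->
  (0 < N p h)%N /\ Sing_red h `<=` V h (Fpn K p (N p h)).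
Proof.
move=> h0; have [s sP] := Sing_finite chK h0.
have [n n0 nP] := Fpn_common (s := s) (fun z _ => K_alg z).
have cn : contains_Sing p h n.
  split=> // -[x y] S; have [xs ys] := sP x y S.
  split; first by split; apply: nP.
  have [fs [P1 P2 _ _]] := irreducible_factors_list h0.
  by have [[f [g [fin _ _ f0 _]]]|[f [fin f0 _ _]]] := Sing_cases P2 S;
    apply: factor_zero (P1 _ fin) f0.
have ex : exists n, `[< contains_Sing p h n >] by exists n; apply/asboolP.
rewrite /N; case: xgetP => [m -> [cm _]|nox]; first exact: cm.
case: (ex_minnP ex) => m /asboolP cm minm; case: (nox m); split=> // k ck.
by apply: minm; apply/asboolP.
Qed.

Definition frobXY n : {poly {poly K}} -> {poly {poly K}} :=
  map_poly (map_poly (frob n chK)).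

HB.instance Definition _ n := GRing.RMorphism.on (frobXY n).

Lemma coef_frobXY n f i j : (frobXY n f)`_i`_j = f`_i`_j ^+ (p ^ n).
Proof. by rewrite /frobXY !coef_map. Qed.

Lemma frobXY_inj n : injective (frobXY n).
Proof.
move=> f g E; apply/polyP => i; apply/polyP => j.
by apply: (@frob_inj p K chK n); rewrite /frob -!coef_frobXY E.
Qed.

Lemma frobXY_surj n g : exists f, frobXY n f = g.
Proof.
have /choice[r rE] := frob_surj chK n.
have r0 : r 0 = 0 by apply: (@frob_inj p K chK n); rewrite rE rmorph0.
exists (map_poly (map_poly r) g).
have rr0 : map_poly r (0 : {poly K}) = 0 by rewrite map_poly0.
apply/polyP => i; apply/polyP => j; rewrite coef_frobXY coef_map_id0 // coef_map_id0 //.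
exact: rE.
Qed.

Lemma frobXYP n g : defined_over (Fpn K p n) g <-> frobXY n g = g.
Proof.
split=> [gP|E i j]; first by apply/polyP => i; apply/polyP => j; rewrite coef_frobXY gP.
by rewrite /Fpn /= -coef_frobXY E.
Qed.

Lemma frobXY_add m n f : frobXY (m + n) f = frobXY m (frobXY n f).
Proof.
by apply/polyP => i; apply/polyP => j; rewrite !coef_frobXY -exprM -expnD addnC.
Qed.

Lemma frobXY_mul n f g : frobXY n (f * g) = frobXY n f * frobXY n g.
Proof. exact: rmorphM. Qed.

Lemma frobXY_dvd m n f : frobXY m f = f -> (m %| n)%N -> frobXY n f = f.
Proof. by move=> /frobXYP E mn; apply/frobXYP => i j; apply: Fpn_dvd mn _ (E i j). Qed.

Lemma frobXY_unit n f : (frobXY n f \is a GRing.unit) = (f \is a GRing.unit).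
Proof.
apply/idP/idP => [/unitXYP[c c0 E]|]; last exact: rmorph_unit.
have [d dE] := frob_surj chK n c.
apply/unitXYP; exists d.
  by apply: contraNneq c0 => d0; rewrite -dE d0 rmorph0.
by apply: (@frobXY_inj n); rewrite E -dE /frobXY map_polyC /= map_polyC.
Qed.

Lemma frobXY_irreducible n f : irreducibleXY f -> irreducibleXY (frobXY n f).
Proof.
move=> [f0 fN irr]; split; first by rewrite (raddf_eq0 _ (@frobXY_inj n)).
  by rewrite frobXY_unit.
move=> a b; have [a' <-] := frobXY_surj n a; have [b' <-] := frobXY_surj n b.
by rewrite -rmorphM => /frobXY_inj/irr; rewrite !frobXY_unit.
Qed.

Lemma frobXY_eval n f x y : (frobXY n f).[x ^+ (p ^ n), y ^+ (p ^ n)] = f.[x, y] ^+ (p ^ n).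
Proof.
rewrite -[RHS]/(frob n chK _) -horner_map /= -horner_map /=; congr _.[_]; congr _.[_].
by rewrite map_polyC.
Qed.

Lemma defined_somewhere f : exists2 n, (0 < n)%N & frobXY n f = f.
Proof.
pose s := flatten [seq polyseq q | q <- polyseq f].
have [n n0 nP] := Fpn_common (s := s) (fun z _ => K_alg z).
exists n => //; apply/frobXYP => i j.
have z0 : Fpn K p n 0 by apply: (rmorph0 (frob n chK)).
have [szi|lti] := leqP (size f) i; first by rewrite (nth_default _ szi) coef0.
have [szj|ltj] := leqP (size f`_i) j; first by rewrite (nth_default _ szj).
apply: nP; apply/flattenP; exists (polyseq f`_i); last exact: mem_nth.
by apply: map_f; apply: mem_nth.
Qed.

(** This normalization picks one polynomial in each class up to scalars and
    commutes with Frobenius; hence a normalized factor whose class is stable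
    under Frobenius has its coefficients in the fixed field. *)
Lemma normalized f : f != 0 ->
  exists2 g, eq_up_to_scalar f g & lead_coef (lead_coef g) = 1.
Proof.
move=> f0; pose c := lead_coef (lead_coef f).
have c0 : c != 0 by rewrite !lead_coef_eq0.
exists (c^-1%:P%:P * f); first by exists c^-1; rewrite ?invr_eq0.
by rewrite lead_coefM lead_coefC lead_coefM lead_coefC mulVf.
Qed.

Lemma normalized_eq f g : lead_coef (lead_coef f) = 1 -> lead_coef (lead_coef g) = 1 ->
  eq_up_to_scalar f g -> f = g.
Proof.
move=> f1 g1 [c c0 E]; move: g1.
rewrite E lead_coefM lead_coefC lead_coefM lead_coefC f1 mulr1 => ->.
by rewrite !polyC1 mul1r.
Qed.

Lemma frobXY_lead n f : lead_coef (lead_coef f) = 1 -> lead_coef (lead_coef (frobXY n f)) = 1.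
Proof.
move=> f1; have i0 : injective (map_poly (frob n chK)).
  by apply: map_inj_poly; [exact: frob_inj | exact: rmorph0].
rewrite /frobXY lead_coef_map_inj ?rmorph0 // lead_coef_map_inj ?rmorph0 //.
  by rewrite f1 rmorph1.
exact: frob_inj.
Qed.

(** Frobenius to the power t * n.+1 moves every component as Frobenius to the
    power t does, because L is chosen so that all components are fixed by
    Frobenius to the power L.  So a rational point lies on a component and on
    its image, which are distinct. *)
Lemma points_in_Sing t h (h0 : h != 0) (ht : frobXY t h = h) :
  ~ (exists g, [/\ defined_over (Fpn K p t) g, divides_over (Fpn K p t) g h &
                   irreducibleXY g]) ->
  exists2 L, (0 < L)%N & forall n, (L %| n)%N ->
    V h (Fpn K p (t * n.+1)) `<=` Sing_red h.
Proof.
move=> noabs; have [fs [P1 P2 _ _]] := irreducible_factors_list h0.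
have [L L0 LP] : exists2 L, (0 < L)%N & forall f, f \in fs ->
    exists2 g, eq_up_to_scalar f g & lead_coef (lead_coef g) = 1 /\ frobXY L g = g.
  have : forall f, f \in fs -> f != 0 by move=> f /P1[[]].
  elim: fs {P1 P2} => [|f fs IHfs] fs0; first by exists 1%N.
  have [|L L0 LP] := IHfs; first by move=> g gin; apply: fs0; rewrite inE gin orbT.
  have [g fg g1] := normalized (fs0 _ (mem_head _ _)).
  have [m m0 mg] := defined_somewhere g.
  exists (m * L)%N; first by rewrite muln_gt0 m0.
  move=> e; rewrite inE => /orP[/eqP->|/LP[e' ee' [e'1 e'L]]].
    by exists g => //; split=> //; apply: (frobXY_dvd mg); apply: dvdn_mulr.
  by exists e' => //; split=> //; apply: (frobXY_dvd e'L); apply: dvdn_mull.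
exists L => // n nL [x y] [[/= xQ yQ] hxy].
have [f0 ff0 f0xy] := zero_on_factor h0 hxy.
have [f fin f0f] := P2 _ ff0; have [irrf fh] := P1 _ fin.
have [g fg [g1 gL]] := LP _ fin.
have gxy : g.[x, y] = 0 by apply: scalar_zero (scalar_trans f0f fg) f0xy.
have irrg : irreducibleXY g.
  move: fg irrf => [c c0 ->] [a b irr]; split.
  - by rewrite mulf_neq0 // !polyC_eq0.
  - by rewrite unitrM (negPf b) andbF.
  have cU : c%:P%:P \is a @GRing.unit {poly {poly K}} by apply/unitXYP; exists c.
  move=> u v E; have := irr (c%:P%:P^-1 * u) v; rewrite -mulrA -E mulKr // => /(_ erefl).
  by rewrite unitrM unitrV cU; case; [left|right].
have gh : irreducible_factor g h.
  split=> //; have [k _ ->] := fh; have [c c0 ->] := scalar_sym fg.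
  by exists (k * c%:P%:P) => //; rewrite mulrA.
pose g' := frobXY t g.
have g'E : g' = frobXY (t * n.+1) g.
  by rewrite mulnS frobXY_add (frobXY_dvd gL (dvdn_mull t nL)).
have g'h : irreducible_factor g' h.
  split; first exact: frobXY_irreducible.
  have [_ [k _ E]] := gh; exists (frobXY t k) => //.
  by rewrite -frobXY_mul -E ht.
apply: (two_components_Sing h0 gh g'h) => //; last first.
  have := frobXY_eval (t * n.+1) g x y; rewrite gxy -g'E xQ yQ => ->.
  exact: (rmorph0 (frob _ chK)).
move=> sc; have gg' := normalized_eq g1 (frobXY_lead t g1) sc.
case: noabs; exists g; split=> //; first by apply/frobXYP.
have [_ [k _ E]] := gh; exists k => //; apply/frobXYP.
have g0 : g != 0 by case: irrg.
by apply: (mulIf g0); rewrite -E {1}gg' -frobXY_mul -E ht.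
Qed.

Lemma infinitely_many_good t h s : (0 < t)%N -> h != 0 -> frobXY t h = h ->
  ~ (exists g, [/\ defined_over (Fpn K p t) g, divides_over (Fpn K p t) g h &
                   irreducibleXY g]) ->
  (gcdn t (N p h) %| s)%N ->
  infinite_set [set n | (0 < n)%N /\ V h (Fpn K p (t * n)) `<=` A2 (Fpn K p s)].
Proof.
move=> t0 h0 ht noabs rs; have [L L0 LP] := points_in_Sing h0 ht noabs.
have [N0 NP] := N_spec h0.
apply/infinite_natP => m.
(* congruent to 1 modulo L and modulo N p h, so that gcdn (t * _) (N p h)
   does not depend on m *)
exists (m * (L * N p h)).+1.
  by apply/leqW; rewrite leq_pmulr // muln_gt0 L0.
split=> // -[x y] P.
have /LP/(_ _ P)/NP[[/= xN yN] _] : (L %| m * (L * N p h))%N.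
  by rewrite mulnCA dvdn_mulr.
have [[/= xt yt] _] := P.
have tn0 : (0 < t * (m * (L * N p h)).+1)%N by rewrite muln_gt0 t0.
have g : (gcdn (t * (m * (L * N p h)).+1) (N p h) %| s)%N.
  by apply: dvdn_trans rs; rewrite mulnS !mulnA addnC gcdnC gcdnMDl gcdnC.
by split; apply: Fpn_dvd g _ _; apply: Fpn_gcd.
Qed.

End FrobeniusOnCurves.

(** * Linear independence over fields of Frobenius powers *)

Section Chain.
Variables (E : fieldType).

Definition subfield_set (S : set E) : Prop :=
  [/\ S 0, S 1, forall x y, S x -> S y -> S (x - y),
      forall x y, S x -> S y -> S (x * y) & forall x, S x -> S x^-1].

Definition dependent (S : set E) n (u : nat -> E) := exists c : nat -> E,
  [/\ forall i, (i < n)%N -> S (c i), exists2 i, (i < n)%N & c i != 0 &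
      \sum_(i < n) c i * u i = 0].

Lemma dependent_sub (S S' : set E) n u : S `<=` S' -> dependent S n u -> dependent S' n u.
Proof. by move=> SS' [c [cS c0 cu]]; exists c; split=> // i /cS/SS'. Qed.

Lemma dependent_widen (S : set E) n u : S 0 -> dependent S n u -> dependent S n.+1 u.
Proof.
move=> S0 [c [cS [i ltin ci0] cu]]; exists (fun i => if i == n then 0 else c i).
split=> [j||].
- by rewrite ltnS leq_eqVlt; case: eqP => //= _ /cS.
- by exists i; [rewrite ltnW|rewrite ltn_eqF].
- rewrite big_ord_recr /= eqxx mul0r addr0 -[RHS]cu; apply: eq_bigr => j _.
  by rewrite ltn_eqF.
Qed.

(** The relation of minimal length, normalized at its last coefficient, is the
    same for all the S k from some k on, so its coefficients lie in all S k. *)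
Lemma dependent_chain (S : nat -> set E) n (u : nat -> E) :
  (forall k, subfield_set (S k)) -> (forall k l, (k <= l)%N -> S l `<=` S k) ->
  (forall k, dependent (S k) n u) -> dependent (\bigcap_k S k) n u.
Proof.
move=> Sf Sd; elim: n => [|n IHn] dep; first by have [c [_ []]] := dep 0%N.
have [/IHn|] := pselect (forall k, dependent (S k) n u).
  by apply: dependent_widen => k _; case: (Sf k).
move/existsNP => [k0 ndep].
have normal k : (k0 <= k)%N -> exists c : nat -> E,
    (forall i, (i < n)%N -> S k (c i)) /\ \sum_(i < n) c i * u i + u n = 0.
  move=> k0k; have [c [cS [i ltin ci0] cu]] := dep k.
  have [cn0|cn0] := eqVneq (c n) 0.
    case: ndep; apply: (dependent_sub (Sd _ _ k0k)); exists c; split.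
    + by move=> j ltj; apply: cS; apply: ltnW.
    + exists i => //; move: ltin; rewrite ltnS leq_eqVlt => /orP[/eqP E1|//].
      by move: ci0; rewrite E1 cn0 eqxx.
    + by move: cu; rewrite big_ord_recr /= cn0 mul0r addr0.
  have [_ _ _ SM SV] := Sf k.
  exists (fun i => (c n)^-1 * c i); split=> [j ltj|].
    by apply: SM; [apply/SV/cS | apply/cS/ltnW].
  apply: (mulfI cn0); rewrite mulr0 -[RHS]cu big_ord_recr /= mulrDr mulr_sumr.
  by congr (_ + _); apply: eq_bigr => j _; rewrite !mulrA mulfV // mul1r.
have [c [cS cu]] := normal k0 (leqnn _).
have cSk k i : (i < n)%N -> S k (c i).
  move=> ltin; have [kk0|/ltnW k0k] := leqP k k0; first exact: Sd kk0 _ (cS i ltin).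
  have [c' [c'S c'u]] := normal k k0k.
  suff -> : c i = c' i by apply: c'S.
  apply: contrapT => /eqP; rewrite -subr_eq0 => cc'; apply: ndep.
  exists (fun i => c i - c' i); split; last first.
  - under eq_bigr do rewrite mulrBl.
    by rewrite sumrB; apply/eqP; rewrite subr_eq0 -(inj_eq (addIr (u n))) cu c'u.
  - by exists i.
  - move=> j ltj; have [_ _ SB _ _] := Sf k0; apply: SB; first exact: cS.
    by apply: Sd k0k _ _; apply: c'S.
exists (fun i => if i == n then 1 else c i); split.
- move=> i; rewrite ltnS leq_eqVlt => lein k _; case: eqP lein => [_ _|_ /= /cSk//].
  by have [] := Sf k.
- by exists n; rewrite ?eqxx ?oner_eq0.
- rewrite big_ord_recr /= eqxx mul1r -[RHS]cu; congr (_ + _); apply: eq_bigr => j _.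
  by rewrite ltn_eqF.
Qed.

Variables (p : nat) (chE : p \in [pchar E]).

Definition frobenius_image (T : set E) k : set E := [set z | exists2 w, T w & z = w ^+ (p ^ k)].

Lemma frobenius_image_subfield T k : subfield_set T -> subfield_set (frobenius_image T k).
Proof.
move=> [T0 T1 TB TM TV]; split.
- by exists 0 => //; rewrite -[RHS]/(frob k chE 0) rmorph0.
- by exists 1 => //; rewrite expr1n.
- move=> _ _ [x Tx ->] [y Ty ->]; exists (x - y); first exact: TB.
  by rewrite -[RHS]/(frob k chE _) rmorphB.
- by move=> _ _ [x Tx ->] [y Ty ->]; exists (x * y); [apply: TM | rewrite exprMn].
- by move=> _ [x Tx ->]; exists x^-1; [apply: TV | rewrite exprVn].
Qed.

Lemma frobenius_image_decr T k l : subfield_set T -> (k <= l)%N ->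
  frobenius_image T l `<=` frobenius_image T k.
Proof.
move=> [T0 T1 _ TM _] kl _ [w Tw ->]; exists (w ^+ (p ^ (l - k))).
  elim: (p ^ _)%N => [|n IHn]; first by rewrite expr0.
  by rewrite exprS; apply: TM.
by rewrite -exprM -expnD subnK.
Qed.

Lemma dependent_frobenius (T : set E) n (u : nat -> E) : subfield_set T ->
  (forall k, dependent (frobenius_image T k) n u) ->
  dependent (\bigcap_k frobenius_image T k) n u.
Proof.
move=> Tf; apply: dependent_chain => k; first exact: frobenius_image_subfield.
by move=> l kl; apply: frobenius_image_decr.
Qed.

End Chain.

(** * Constants of the function field of a plane curve *)

Section FractionField.
Variable K : closedFieldType.
Implicit Types (a b c : {poly K}).
Local Notation F := {fraction {poly K}}.
Local Notation fr := (@tofrac {poly K}).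

Lemma fraction_repr (R : idomainType) (z : {fraction R}) :
  exists x y : R, y != 0 /\ z * tofrac y = tofrac x.
Proof.
elim/quotW: z => r; exists r.1, r.2; split; first exact: denom_ratioP.
rewrite !piE; apply/eqmodP; rewrite /= FracField.equivfE /FracField.mulf.
rewrite !numden_Ratio ?(oner_eq0, mulf_neq0, denom_ratioP) //.
by rewrite !mulr1 mulrC.
Qed.

Lemma fraction_coprime (z : F) : exists a b, [/\ b != 0, coprimep a b & z * fr b = fr a].
Proof.
have [a [b [b0 E]]] := fraction_repr z.
have g0 : gcdp a b != 0 by rewrite gcdp_eq0 (negPf b0) andbF.
exists (a %/ gcdp a b), (b %/ gcdp a b); split.
- by rewrite dvdp_div_eq0 ?dvdp_gcdr.
- by rewrite coprimep_div_gcd // b0 orbT.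
have g0F : fr (gcdp a b) != 0 by rewrite tofrac_eq0.
by apply: (mulIf g0F); rewrite -mulrA -!tofracM !divpK ?dvdp_gcdl ?dvdp_gcdr.
Qed.

(** If a / b = (a_k / b_k) ^ (p ^ k) in lowest terms for all k, then p ^ k
    divides the degrees of a and b. *)
Lemma fraction_infinitely_frobenius p (z : F) : (1 < p)%N ->
  (forall k, exists w, z = w ^+ (p ^ k)) -> exists c : K, z = fr c%:P.
Proof.
move=> p1 zP; have [a [b [b0 ab zE]]] := fraction_coprime z.
(* p ^ k exceeds the degrees of a and b, so c and d below must be constant *)
pose k := (size a + size b)%N; have [w wE] := zP k.
have [c [d [d0 cd cE]]] := fraction_coprime w.
have M : a * d ^+ (p ^ k) = c ^+ (p ^ k) * b.
  apply/eqP; rewrite -tofrac_eq !tofracM !tofracXn -zE -cE wE exprMn.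
  by rewrite mulrAC.
have [a0|a0] := eqVneq a 0.
  exists 0; rewrite polyC0 tofrac0; apply/eqP; have/eqP := zE.
  by rewrite a0 tofrac0 mulf_eq0 tofrac_eq0 (negPf b0) orbF.
have ltk : (k < p ^ k)%N by apply: ltn_expl.
have pow_small (q e : {poly K}) :
    q != 0 -> q ^+ (p ^ k) %| e -> e != 0 -> (size e <= k)%N -> size q = 1%N.
  move=> q0 qe e0 sek; have := leq_trans (leq_pred _) (leq_trans (dvdp_leq e0 qe) sek).
  rewrite size_exp => H; apply/eqP; rewrite eqn_leq size_poly_gt0 q0 andbT.
  rewrite leqNgt; apply: contraL ltk => s1; rewrite -leqNgt; apply: leq_trans H.
  by rewrite leq_pmull // -subn1 subn_gt0.
have c0 : c != 0.
  apply: contraNneq a0 => c0; move/eqP: M; rewrite c0 expr0n expn_eq0.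
  rewrite gtn_eqF ?(ltnW p1) //= mul0r mulf_eq0 expf_eq0 (negPf d0) andbF orbF.
  by [].
have sc : size c = 1%N.
  apply: (pow_small c a) => //; last exact: leq_addr.
  rewrite -(@Gauss_dvdpl _ a (d ^+ (p ^ k))); last exact: coprimep_expr (coprimep_expl _ _).
  by rewrite M dvdp_mulr.
have sd : size d = 1%N.
  apply: (pow_small d b) => //; last exact: leq_addl.
  rewrite -(@Gauss_dvdpr _ b (c ^+ (p ^ k))).
    by rewrite -M dvdp_mull.
  by rewrite coprimep_sym; apply: coprimep_expl; apply: coprimep_expr.
have [c1 c10 c1E] := size_poly1P _ (introT eqP sc).
have [d1 d10 d1E] := size_poly1P _ (introT eqP sd).
exists ((c1 / d1) ^+ (p ^ k)); rewrite wE polyC_exp tofracXn; congr (_ ^+ _).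
have d0F : fr d != 0 by rewrite tofrac_eq0.
by apply: (mulIf d0F); rewrite cE -tofracM d1E c1E -polyCM divfK.
Qed.

Lemma scale_polyC (R : comNzRingType) (x y z : R) : (x * y) *: z%:P = x%:P * (z * y)%:P.
Proof. by rewrite -mul_polyC -!polyCM -mulrA [y * z]mulrC. Qed.

Lemma clear_denominators (P : {poly F}) :
  exists c (A : {poly {poly K}}), c != 0 /\ (fr c) *: P = map_poly fr A.
Proof.
elim/poly_ind: P => [|P z [c [A [c0 E]]]].
  by exists 1, 0; rewrite oner_eq0 scaler0 rmorph0.
have [a [b [b0 zE]]] := fraction_repr z.
exists (c * b), (b *: A * 'X + (c * a)%:P); rewrite mulf_neq0 //; split=> //.
rewrite rmorphD !rmorphM /= map_polyX map_polyC map_polyZ /= -E.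
rewrite scalerDr -!scalerAl scalerA [fr b * _]mulrC; congr (_ + _).
rewrite map_polyC /= -zE; exact: scale_polyC.
Qed.

Lemma irreducible_over_fractions (G : {poly {poly K}}) : (1 < size G)%N ->
  (forall c A B, c != 0 -> c *: G = A * B -> size A = 1%N \/ size B = 1%N) ->
  irreducible_poly (map_poly fr G).
Proof.
move=> sG irr; have inj : injective fr by move=> a b /eqP; rewrite tofrac_eq => /eqP.
have sm A : size (map_poly fr A) = size A by rewrite size_map_inj_poly ?tofrac0.
split=> [|q sq /dvdpP[s' E']]; first by rewrite sm.
have [s E] : exists s : {poly F}, map_poly fr G = s * q by exists s'.
have [a [A [a0 AE]]] := clear_denominators s.
have [b [B [b0 BE]]] := clear_denominators q.
have a0F : fr a != 0 by rewrite tofrac_eq0.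
have b0F : fr b != 0 by rewrite tofrac_eq0.
have sB : size B = size q by rewrite -(sm B) -BE (size_scale _ b0F).
have sA : size A = size s by rewrite -(sm A) -AE (size_scale _ a0F).
have M : (a * b) *: G = A * B.
  apply: (map_inj_poly inj (tofrac0 _)).
  have -> : map_poly fr (A * B) = map_poly fr A * map_poly fr B by apply: rmorphM.
  by rewrite map_polyZ -AE -BE /= E tofracM -scalerAl -scalerAr scalerA.
have [s1|/eqP] := irr _ _ _ (mulf_neq0 a0 b0) M; last by rewrite sB (negPf sq).
move: s1; rewrite sA => /eqP/size_poly1P[e e0 sE].
by rewrite E sE mul_polyC eqp_sym eqp_scale.
Qed.

End FractionField.

Section FunctionField.
Variables (p : nat) (K : closedFieldType) (chK : p \in [pchar K]).
Local Notation F := {fraction {poly K}}.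
Local Notation fr := (@tofrac {poly K}).
Variable L : fieldExtType F.

Definition base_const : K -> L := in_alg L \o fr \o polyC.

HB.instance Definition _ := GRing.RMorphism.on base_const.

Lemma pchar_function_field : p \in [pchar L].
Proof. exact: (rmorph_pchar base_const chK). Qed.

Lemma closed_root_in_base (Q : {poly K}) (w : L) : Q != 0 ->
  root (map_poly base_const Q) w -> exists c, w = base_const c.
Proof.
have [rs ->] := closed_field_poly_normal Q; rewrite scaler_eq0 lead_coef_eq0.
case/norP => Q0 _; rewrite map_polyZ rootZ ?fmorph_eq0 ?lead_coef_eq0 //.
rewrite map_prod_XsubC -(big_map base_const predT (fun z => 'X - z%:P)).
by rewrite root_prod_XsubC => /mapP[c _ ->]; exists c.
Qed.

(** Let v be a p^k-th root of w, and d the degree of L over F.  The p^k-th power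
    of a linear relation over F between 1, v, ..., v^d is a relation between
    1, w, ..., w^d over F^(p^k).  As this is so for all k, these powers of w are
    dependent over the intersection of the F^(p^k), which is K; so w is
    algebraic over the algebraically closed field K. *)
Lemma function_field_infinitely_frobenius (w : L) :
  (forall k, exists v, w = v ^+ (p ^ k)) -> exists c, w = base_const c.
Proof.
move=> wP; have chL := pchar_function_field.
pose T : set L := [set z | exists f : F, z = f%:A].
have Tf : subfield_set T.
  split.
  - by exists 0; rewrite scale0r.
  - by exists 1; rewrite scale1r.
  - by move=> _ _ [f ->] [g ->]; exists (f - g); rewrite scalerBl.
  - by move=> _ _ [f ->] [g ->]; exists (f * g); rewrite -(rmorphM (in_alg L)).
  - by move=> _ [f ->]; exists f^-1; rewrite -(fmorphV (in_alg L)).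
have [k|c [cT [i0 lti0 ci0] cw]] :=
    @dependent_frobenius L p chL T (\dim {:L}).+1 (fun i => w ^+ i) Tf.
  have [v vE] := wP k.
  have /polyOver1P[q qE] := minPolyOver 1%AS v.
  have q0 : q != 0.
    apply: contraTneq (monic_minPoly 1%AS v) => q0.
    by rewrite qE q0 rmorph0 monicE lead_coef0 eq_sym oner_eq0.
  have sq : (size q <= (\dim {:L}).+1)%N.
    rewrite -(size_map_poly (in_alg L)) -qE size_minPoly ltnS.
    by have := dim_Fadjoin 1%AS v; rewrite dimv1 muln1 => <-; apply/dimvS/subvf.
  exists (fun i => (q`_i)%:A ^+ (p ^ k)); split.
  - by move=> i _; exists (q`_i)%:A => //; exists q`_i.
  - exists (size q).-1; first by rewrite prednK ?size_poly_gt0.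
    by rewrite expf_neq0 // scaler_eq0 oner_eq0 orbF -lead_coefE lead_coef_eq0.
  - transitivity (\sum_(i < (\dim {:L}).+1) ((q`_i)%:A * v ^+ i) ^+ (p ^ k)).
      by apply: eq_bigr => i _; rewrite vE exprMn -!exprM mulnC.
    rewrite -(frob_sum chL) [X in X ^+ _](_ : _ = (minPoly 1%AS v).[v]).
      by rewrite (rootP (root_minPoly _ _)); apply: (rmorph0 (frob k chL)).
    rewrite qE (@horner_coef_wide _ (\dim {:L}).+1) ?size_map_poly //.
    by apply: eq_bigr => i _; rewrite coef_map.
have /choice[e eE] : forall i, exists e : K, (i < (\dim {:L}).+1)%N -> c i = base_const e.
  move=> i; have [lti|_] := ltnP i (\dim {:L}).+1; last by exists 0.
  have cPi k : exists f : F, c i = (f ^+ (p ^ k))%:A.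
    have [_ [f ->] ->] := cT i lti k Logic.I; exists f.
    by apply: esym; apply: (rmorphXn (in_alg L)).
  have [f0 f0E] := cPi 0%N.
  have [k|e eE] := @fraction_infinitely_frobenius K p f0 (prime_gt1 (pcharf_prime chK)).
    have [f fE] := cPi k; exists f; apply: (fmorph_inj (in_alg L)) => /=.
    by rewrite -fE f0E expn0 expr1.
  by exists e => _; rewrite f0E eE expn0 expr1.
apply: (@closed_root_in_base (\poly_(i < (\dim {:L}).+1) e i)).
  apply: contraNneq ci0 => Q0; rewrite eE //.
  have := congr1 (fun q : {poly K} => q`_i0) Q0; rewrite coef_poly lti0 coef0 => ->.
  by rewrite rmorph0.
apply/rootP; rewrite (@horner_coef_wide _ (\dim {:L}).+1); last first.
  by rewrite size_map_poly; exact: size_poly.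
rewrite -[RHS]cw; apply: eq_bigr => i _.
by rewrite coef_map coef_poly ltn_ord /= eE.
Qed.

End FunctionField.

Section MonicDivision.
Variable K : closedFieldType.
Implicit Types P : {poly {poly K}}.

(** Each division step lowers the degree in x by one, at the cost of raising
    the degree in y of the coefficients by at most e. *)
Lemma monic_division (G : {poly {poly K}}) (d e : nat) : G \is monic -> size G = d.+1 ->
  (forall i, (size (G`_i)%R <= e.+1)%N) ->
  forall k D P, (size P <= d + k)%N -> (forall i, (size (P`_i)%R <= D)%N) ->
  exists q r, [/\ P = q * G + r, (size r <= d)%N &
                  forall i, (size (r`_i)%R <= D + k * e)%N].
Proof.
move=> mG sG Ge; elim=> [|k IHk] D P sP PD.
  by exists 0, P; rewrite mul0r add0r addn0 in sP *; split=> // i; rewrite addn0.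
pose c := P`_(d + k); pose P' := P - c%:P * (G * 'X^k).
have sP' : (size P' <= d + k)%N.
  apply/leq_sizeP => j; rewrite leq_eqVlt => /orP[/eqP <-|ltj].
    rewrite coefB coefCM coefMXn ltnNge leq_addl /= addnK.
    have := monicP mG; rewrite lead_coefE sG /= => ->; rewrite mulr1; exact: subrr.
  rewrite coefB coefCM coefMXn ltnNge (leq_trans (leq_addl d k) (ltnW ltj)) /=.
  rewrite [P`_j]nth_default ?(leq_trans sP) ?addnS //.
  by rewrite [G`__]nth_default ?mulr0 ?subrr // sG; lia.
have PD' i : (size (P'`_i)%R <= D + e)%N.
  rewrite coefB coefCM coefMXn; apply: leq_trans (size_polyD _ _) _.
  rewrite size_polyN geq_max (leq_trans (PD i)) ?leq_addr //=.
  case: ifP => _; first by rewrite mulr0 size_poly0.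
  have arith (a b : nat) : (a <= D -> b <= e.+1 -> (a + b).-1 <= D + e)%N by lia.
apply: leq_trans (size_polyMleq _ _) _; apply: arith; [exact: PD|exact: Ge].
have [q [r [P'E sr rD]]] := IHk (D + e)%N P' sP' PD'.
exists (q + c%:P * 'X^k), r; split=> //; last by move=> i; rewrite mulSn addnA.
by rewrite mulrDl -addrA [_ + r]addrC addrA -P'E /P' -mulrA [G * _]mulrC subrK.
Qed.

Lemma monic_dvd_small (G r q : {poly {poly K}}) : G \is monic ->
  (size r < size G)%N -> r = q * G -> r = 0.
Proof.
move=> mG sr E; apply/eqP; apply: contraTT sr => r0; rewrite -leqNgt E.
have q0 : q != 0 by apply: contraNneq r0 => q0; rewrite E q0 mul0r.
rewrite size_Mmonic // -[X in (X <= _)%N]add0n -subn1 -addnBA ?size_poly_gt0 ?monic_neq0 //.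
by have := size_poly_gt0 q; have := size_poly_gt0 G; rewrite q0 (monic_neq0 mG); lia.
Qed.

End MonicDivision.

Section Independence.
Variables (p : nat) (K : closedFieldType) (chK : p \in [pchar K]).
Implicit Types (f g h P : {poly {poly K}}) (c : {poly K}).
Local Notation fr := (@tofrac {poly K}).

(** Irreducibility in K(y)[x], expressed without denominators; it survives the
    change of variable that makes G monic. *)
Definition irreducible_generic (G : {poly {poly K}}) :=
  forall c A B, c != 0 -> c *: G = A * B -> size A = 1%N \/ size B = 1%N.

(** If the u i were dependent over the p^k-th powers of the function field of
    G = 0 for every k, they would be dependent over the intersection of these
    fields, which is K.  That k depends only on G and u is what allows it to be
    fixed while the size of the finite field grows. *)
Lemma frobenius_independence (G : {poly {poly K}}) n (u : nat -> {poly {poly K}}) :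
  G \is monic -> (1 < size G)%N -> irreducible_generic G ->
  (forall c : nat -> K, dvdXY G (\sum_(i < n) (c i)%:P%:P * u i) ->
     forall i, (i < n)%N -> c i = 0) ->
  exists k, forall w : nat -> {poly {poly K}},
    dvdXY G (\sum_(i < n) w i ^+ (p ^ k) * u i) -> forall i, (i < n)%N -> dvdXY G (w i).
Proof.
move=> mG sG irrG ind.
have irrF := irreducible_over_fractions sG irrG.
have [L _ [z zroot _]] := irredp_FAdjoin irrF.
have chL := pchar_function_field chK L.
pose ev P : L := (map_poly (in_alg L \o fr) P).[z].
have evD P Q : ev (P + Q) = ev P + ev Q by rewrite /ev rmorphD hornerD.
have evM P Q : ev (P * Q) = ev P * ev Q by rewrite /ev rmorphM hornerM.
have ev0 : ev 0 = 0 by rewrite /ev rmorph0 horner0.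
have evX P k : ev (P ^+ k) = ev P ^+ k by rewrite /ev rmorphXn horner_exp.
have evS m (f : nat -> {poly {poly K}}) : ev (\sum_(i < m) f i) = \sum_(i < m) ev (f i).
  by elim: m => [|m IHm]; rewrite ?big_ord0 // !big_ord_recr /= evD IHm.
have evC (c : K) : ev c%:P%:P = @base_const K L c by rewrite /ev map_polyC hornerC.
have evG : ev G = 0 by apply/rootP; rewrite map_poly_comp.
have inj : injective fr by move=> a b /eqP; rewrite tofrac_eq => /eqP.
have szm P : size (map_poly fr P) = size P by rewrite size_map_inj_poly ?tofrac0.
have ev_small (r : {poly {poly K}}) : (size r < size G)%N -> ev r = 0 -> r = 0.
  move=> sr evr; apply: contrapT => /eqP r0.
  have cop : coprimep (map_poly fr G) (map_poly fr r).
    rewrite coprimep_def; apply: contraTT sr => sg; rewrite -leqNgt -!szm.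
    have r'0 : map_poly fr r != 0 by rewrite -size_poly_eq0 szm size_poly_eq0.
    have [_ /(_ _ sg (dvdp_gcdl _ _)) /eqp_size <-] := irrF.
    exact: dvdp_leq r'0 (dvdp_gcdr _ _).
  have [[a b] /= /(congr1 (fun q => (map_poly (in_alg L) q).[z]))] := Bezout_eq1_coprimepP _ _ cop.
  rewrite rmorphD !rmorphM rmorph1 /= hornerD !hornerM hornerC.
  rewrite -!(map_poly_comp (in_alg L)) -/(ev r) -/(ev G) evr evG !mulr0 addr0.
  by move/eqP; rewrite eq_sym oner_eq0.
have ev_dvd P : dvdXY G P <-> ev P = 0.
  split=> [[q ->]|evP]; first by rewrite evM evG mulr0.
  have [d sd] : exists d, size G = d.+1 by exists (size G).-1; rewrite prednK ?(ltnW sG).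
  have [q [r [PE sr _]]] := @monic_division K G d (sizeY G) mG sd
      (fun i => leqW (max_size_coefXY G i)) (size P) _ P (leq_addl _ _) (max_size_coefXY P).
  exists q; rewrite PE [r]ev_small ?addr0 ?sd //.
  by move: evP; rewrite PE evD evM evG mulr0 add0r.
apply: contrapT => /forallNP nex.
have Tf : subfield_set [set: L] by [].
have [k|c [cT [i lti ci] cu]] := @dependent_frobenius L p chL setT n (fun i => ev (u i)) Tf.
  have /existsNP[w /not_implyP[wd /existsNP[i /not_implyP[lti wi]]]] := nex k.
  exists (fun i => ev (w i) ^+ (p ^ k)); split.
  - by move=> j _; exists (ev (w j)).
  - by exists i => //; rewrite expf_neq0 //; apply/eqP => /ev_dvd.
  - move/ev_dvd: wd; rewrite (evS n (fun i => w i ^+ (p ^ k) * u i)) => wd.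
    by rewrite -[RHS]wd; apply: eq_bigr => j _; rewrite evM evX.
have /choice[e eE] : forall i, exists e : K, (i < n)%N -> c i = base_const L e.
  move=> j; have [ltj|_] := ltnP j n; last by exists 0.
  have [k|e eE] := @function_field_infinitely_frobenius p K chK L (c j).
    by have [v _ vE] := cT j ltj k Logic.I; exists v.
  by exists e.
case/eqP: ci; rewrite eE // (ind e) ?rmorph0 //; apply/ev_dvd.
rewrite (evS n (fun i => (e i)%:P%:P * u i)) -[RHS]cu; apply: eq_bigr => j _.
by rewrite evM evC eE.
Qed.

End Independence.

(** * The auxiliary polynomial *)

Lemma linear_system (K : fieldType) (I J : finType) (A : I -> J -> K) :
  (#|J| < #|I|)%N ->
  exists c : I -> K, (exists i, c i != 0) /\ forall j, \sum_i c i * A i j = 0.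
Proof.
move=> lt; pose B : 'M[K]_(#|I|, #|J|) := \matrix_(i, j) A (enum_val i) (enum_val j).
have /rowV0Pn[v /sub_kermxP vB v0] : kermx B != 0.
  by rewrite -mxrank_eq0 mxrank_ker subn_eq0 -ltnNge (leq_ltn_trans (rank_leq_col _)).
exists (fun i => v 0 (enum_rank i)); split.
  have /rV0Pn[i vi] := v0; by exists (enum_val i); rewrite enum_valK.
move=> j; have /(congr1 (fun w : 'rV_ _ => w 0 (enum_rank j))) := vB.
rewrite !mxE => E; rewrite -[RHS]E (reindex_onto enum_val enum_rank) /=; last first.
  by move=> i _; rewrite enum_rankK.
apply: eq_big => [i|i _]; first by rewrite enum_valK eqxx.
by rewrite enum_valK !mxE enum_rankK.
Qed.

Lemma drop_poly_horner (R : comNzRingType) (g : {poly R}) r x :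
  (drop_poly r g).[x] = g`_r + x * (drop_poly r.+1 g).[x].
Proof.
have -> : drop_poly r g = (g`_r)%:P + 'X * drop_poly r.+1 g.
  apply/polyP => -[|i]; rewrite coefD coefC coefXM !coef_drop_poly /=.
    by rewrite addr0.
  by rewrite add0r addSnnS.
by rewrite hornerD hornerC hornerM hornerX.
Qed.

(** The values at x of the polynomials [drop_poly r.+1 g] are the partial
    results of Horner's scheme, hence the coefficients of the quotient of
    g(Z) - g(x) by Z - x. *)
Lemma difference_quotient (R : comNzRingType) (g : {poly R}) d x z : (size g <= d.+1)%N ->
  (\sum_(r < d) (drop_poly r.+1 g).[x] * z ^+ r) * (z - x) = g.[z] - g.[x].
Proof.
move=> sg.
have partial n : (\sum_(r < n) (drop_poly r.+1 g).[x] * z ^+ r) * (z - x) =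
    (drop_poly n g).[x] * z ^+ n - (drop_poly 0 g).[x] + \sum_(r < n) g`_r * z ^+ r.
  elim: n => [|n IHn].
    by rewrite !big_ord0 mul0r expr0 mulr1 subrr addr0.
  rewrite !big_ord_recr /= mulrDl IHn (drop_poly_horner _ n) exprS.
  set D := (drop_poly n.+1 g).[x]; set D0 := (drop_poly 0 g).[x].
  set S := \sum_(i < n) _; set Z := z ^+ n.
  ring.
have topE : (drop_poly d g).[x] = g`_d.
  by rewrite drop_poly_horner (drop_poly_eq0 sg) horner0 mulr0 addr0.
rewrite partial topE drop_poly0l (horner_coef_wide z sg) big_ord_recr /=.
by rewrite addrAC [_ + \sum_(i < d) _]addrC.
Qed.

Lemma Fpn_seq p (K : closedFieldType) (iota : {rmorphism 'F_p -> K}) n :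
  prime p -> (0 < n)%N ->
  exists s : seq K, [/\ uniq s, size s = (p ^ n)%N & forall z, z \in s <-> Fpn K p n z].
Proof.
move=> p_pr n0; have := card_Fpn iota p_pr n0.
have : finite_set (Fpn K p n) by apply/finite_setP; exists (p ^ n)%N; apply: card_Fpn.
case/finite_fsetP => X ->; move/card_eq_fsetP => cX.
by exists X; split=> //; exact: fset_uniq.
Qed.

Section Fiber.
Variable K : closedFieldType.
Implicit Types (P G : {poly {poly K}}).

Definition fiber (b : K) : {poly {poly K}} -> {poly K} := map_poly (horner_eval b).

HB.instance Definition _ b := GRing.RMorphism.on (fiber b).

Lemma fiber_horner b P x : (fiber b P).[x] = P.[x, b].
Proof. by rewrite /fiber -horner_swapXY horner2_swapXY. Qed.

Lemma horner2_sum (I : Type) (r : seq I) (P : pred I) (F : I -> {poly {poly K}}) x y :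
  (\sum_(i <- r | P i) F i).[x, y] = \sum_(i <- r | P i) (F i).[x, y].
Proof. by rewrite !horner_sum. Qed.

Lemma horner2_exp (P : {poly {poly K}}) n x y : (P ^+ n).[x, y] = P.[x, y] ^+ n.
Proof. by rewrite !horner_exp. Qed.

(** The polynomial rho is a Bezout constant of G and its derivative in x; where
    it does not vanish, the fiber of G is coprime to its derivative. *)
Lemma separable_fibers G : G \is monic -> irreducible_generic G -> G^`() != 0 ->
  exists2 rho : {poly K}, rho != 0 & forall b, rho.[b] != 0 ->
    exists2 rs, uniq rs & fiber b G = \prod_(r <- rs) ('X - r%:P).
Proof.
move=> mG irr dG0.
have cop : size (gcdp G G^`()) = 1%N.
  have /Pdiv.Idomain.dvdpP[[c q] /= c0 E] := dvdp_gcdl G G^`().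
  have [/eqP/size_poly1P[q0 q00 qE]|//] := irr _ _ _ c0 E.
  have := dvdp_leq dG0 (dvdp_gcdr G G^`()).
  rewrite -(size_scale _ q00) -mul_polyC -qE -E size_scale // leqNgt lt_size_deriv //.
  exact: monic_neq0.
have [[u v] /= /eqpP[[c1 c2] /= /andP[c10 c20] E]] := Bezoutp G G^`().
have [g g0 gE] := size_poly1P _ (introT eqP cop).
exists (c2 * g); first by rewrite mulf_neq0.
move=> b rb; have [rs rsE] := closed_field_poly_normal (fiber b G).
have mb : fiber b G \is monic by apply: monic_map.
exists rs; last by rewrite {1}rsE (monicP mb) scale1r.
move: rsE; rewrite (monicP mb) scale1r => rsE.
rewrite -separable_prod_XsubC -rsE unlock.
have dfib : (fiber b G)^`() = fiber b G^`() by rewrite /fiber deriv_map.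
pose k := c1.[b] / (c2 * g).[b].
apply/Bezout_eq1_coprimepP; exists (k *: fiber b u, k *: fiber b v); rewrite /k.
rewrite /= dfib -!scalerAl -scalerDr -!rmorphM -rmorphD /=.
have := congr1 (fiber b) E; rewrite gE /fiber !map_polyZ map_polyC /= /horner_eval => EE.
rewrite mulrC -scalerA EE scalerA -mul_polyC -polyCM -mulrA -hornerM mulVf //.
Qed.

End Fiber.

Section Stepanov.
Variables (K : closedFieldType) (d e : nat) (G : {poly {poly K}}).
Hypotheses (d_gt0 : (0 < d)%N) (mG : G \is monic) (sG : size G = d.+1).
Hypothesis Ge : forall i, (size (G`_i)%R <= e.+1)%N.

Definition monomXY a b : {poly {poly K}} := ('X^a)%:P * 'X^b.

(** The monomials of degree < d in x, in an order such that the first n * d of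
    them are those of degree < n in y. *)
Definition monom i := monomXY (i %/ d) (i %% d).

Lemma coef_monomXY_mul a b (s : {poly {poly K}}) j :
  (monomXY a b * s)`_j = if (j < b)%N then 0 else 'X^a * s`_(j - b).
Proof. by rewrite /monomXY -mulrA coefCM mulrC coefXnM; case: ifP; rewrite ?mul0r // mulrC. Qed.

Lemma monomXY_exp a b n : monomXY a b ^+ n = monomXY (a * n) (b * n).
Proof. by rewrite /monomXY exprMn -polyC_exp -!exprM. Qed.

Lemma monomXY_mul a b a' b' : monomXY a b * monomXY a' b' = monomXY (a + a') (b + b').
Proof. by rewrite /monomXY mulrACA -polyCM -!exprD. Qed.

Lemma horner_monomXY a b x y : (monomXY a b).[x, y] = y ^+ a * x ^+ b.
Proof. by rewrite /monomXY hornerM hornerC hornerXn hornerM hornerXn horner_exp hornerC. Qed.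

Lemma size_monomXY_mul a b (s : {poly {poly K}}) : (size (monomXY a b * s)%R <= b + size s)%N.
Proof.
apply/leq_sizeP => j; rewrite coef_monomXY_mul => lej.
case: ifP => // _; by rewrite nth_default ?mulr0 // -[X in (X <= _)%N](addKn b) leq_sub2r.
Qed.

Lemma size_coef_monomXY_mul a b (s : {poly {poly K}}) D j :
  (forall i, size (s`_i)%R <= D)%N -> (size ((monomXY a b * s)%R`_j)%R <= a + D)%N.
Proof.
move=> sD; rewrite coef_monomXY_mul; case: ifP => _; first by rewrite size_poly0.
apply: leq_trans (size_polyMleq _ _) _; rewrite size_polyXn addSn /=.
by rewrite leq_add2l.
Qed.

Lemma coef_monom_comb n (c : nat -> K) i : (i < n)%N ->
  (\sum_(l < n) (c l)%:P%:P * monom l)`_(i %% d)`_(i %/ d) = c i.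
Proof.
move=> lti; rewrite !coef_sum (bigD1 (Ordinal lti)) //= big1 => [|l /eqP nl].
  by rewrite addr0 2!coefCM /monom /monomXY coefMXn ltnn subnn coefC eqxx coefXn eqxx mulr1.
rewrite 2!coefCM /monom /monomXY coefMXn; case: ltnP => [_|lel]; first by rewrite coef0 mulr0.
rewrite coefC; case: eqP => [E|_]; last by rewrite coef0 mulr0.
rewrite coefXn; case: eqP => [E'|_]; last by rewrite mulr0.
case: nl; apply: val_inj => /=; rewrite (divn_eq l d) (divn_eq i d) E'.
by congr (_ + _)%N; apply/eqP; rewrite eqn_leq lel -subn_eq0 E.
Qed.

Lemma size_monom_comb n (c : nat -> K) :
  (size (\sum_(l < n) (c l)%:P%:P * monom l)%R <= d)%N.
Proof.
apply/leq_sizeP => j ledj; rewrite coef_sum big1 // => l _.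
have ltd := ltn_pmod l d_gt0.
rewrite coefCM /monom /monomXY coefMXn ltnNge (leq_trans (ltnW ltd) ledj) /= coefC subn_eq0.
by rewrite leqNgt (leq_trans ltd ledj) mulr0.
Qed.

Lemma monom_independent n (c : nat -> K) :
  dvdXY G (\sum_(l < n) (c l)%:P%:P * monom l) -> forall i, (i < n)%N -> c i = 0.
Proof.
move=> [q E] i lti; rewrite -(coef_monom_comb c lti) (monic_dvd_small mG _ E) ?coef0 //.
by rewrite sG ltnS size_monom_comb.
Qed.

(** The sum is a polynomial in z of degree < d.  It vanishes at the roots of G
    other than x if it is a multiple of G(z) / (z - x), that is, if each of its
    coefficients of index r < d - 1 is the one of index d - 1 times the r-th
    coefficient of that quotient.  Modulo G, each of these d - 1 equations
    between functions on the curve amounts to d equations between polynomials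
    in y, the degrees of which are controlled by [monic_division]; the
    hypothesis compares the resulting number of scalar equations with the
    number of unknowns. *)
Lemma auxiliary_coefficients M m L :
  (d.-1 * d * (m * M + L + e + d.-1 * M * e) < m.+1 * d * (L * d))%N ->
  exists C : nat -> nat -> K,
    (exists i l, [/\ (i < m.+1 * d)%N, (l < L * d)%N & C i l != 0]) /\
    forall x y z, G.[x, y] = 0 -> G.[z, y] = 0 -> z != x ->
      \sum_(i < m.+1 * d) \sum_(l < L * d)
         C i l * (monom i).[x, y] ^+ M * (y ^+ (l %/ d) * z ^+ (l %% d)) = 0.
Proof.
set D := (_ + d.-1 * M * e)%N => count.
(* With r := l %% d, the coefficient of C i l in the r'-th equation is
   B i l r', where s r r' puts together the r'-th coefficient of z ^ r and the
   one of the multiple of the quotient that corresponds to index d - 1. *)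
pose s r r' : {poly {poly K}} := (r == r')%:R - (r == d.-1)%:R * drop_poly r'.+1 G.
pose B i l r := monomXY (i %/ d * M + l %/ d) (i %% d * M) * s (l %% d)%N r.
have nat_coef (b : bool) j : (size ((b%:R : {poly {poly K}})`_j)%R <= 1)%N.
  by rewrite -[b%:R]polyC_natr coefC; case: eqP => _; case: b; rewrite ?size_poly0 ?size_poly1.
have ss r r' : (size (s r r') <= d)%N.
  rewrite /s; case: (r == d.-1); rewrite ?mul1r ?mul0r ?subr0.
    apply: leq_trans (size_polyD _ _) _; rewrite size_polyN size_drop_poly sG geq_max.
    by case: eqP => _; rewrite ?size_poly1 ?size_poly0 ?subSS ?leq_subr ?andbT.
  by case: eqP => _; rewrite ?size_poly1 ?size_poly0.
have sc r r' i : (size ((s r r')`_i)%R <= e.+1)%N.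
  rewrite /s coefB; apply: leq_trans (size_polyD _ _) _; rewrite size_polyN geq_max.
  apply/andP; split; first by apply: leq_trans (nat_coef _ _) _.
  case: (r == d.-1); rewrite ?mul1r ?mul0r ?coef0 ?size_poly0 //.
  by rewrite coef_drop_poly.
have /choice[R RP] : forall ilr : nat * nat * nat, exists r : {poly {poly K}},
    (ilr.1.1 < m.+1 * d)%N -> (ilr.1.2 < L * d)%N ->
    [/\ exists q, B ilr.1.1 ilr.1.2 ilr.2 = q * G + r, (size r <= d)%N &
        forall i, (size (r`_i)%R <= D)%N].
  move=> [[i l] r] /=; have [lti|_] := ltnP i (m.+1 * d); last by exists 0.
  have [ltl|_] := ltnP l (L * d); last by exists 0.
  have im : (i %/ d <= m)%N by rewrite -ltnS ltn_divLR.
  have lL : (l %/ d < L)%N by rewrite ltn_divLR.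
  have id1 : (i %% d <= d.-1)%N by rewrite -ltnS prednK // ltn_pmod.
  have sB : (size (B i l r) <= d + d.-1 * M)%N.
    apply: leq_trans (size_monomXY_mul _ _ _) _; rewrite addnC leq_add //.
    by rewrite leq_mul2r id1 orbT.
  have sBc j : (size ((B i l r)`_j)%R <= (m * M + L.-1) + e.+1)%N.
    apply: leq_trans (size_coef_monomXY_mul _ _ _ (sc _ _)) _.
    rewrite leq_add2r leq_add ?leq_mul2r ?im ?orbT //; lia.
  have [q [r' [E sr' rD]]] := monic_division mG sG Ge sB sBc.
  exists r' => _ _; split=> [||j] //; first by exists q.
  by apply: leq_trans (rD j) _; rewrite /D; have := leq_ltn_trans (leq0n _) lL; lia.
pose A (il : 'I_(m.+1 * d) * 'I_(L * d)) (j : 'I_d.-1 * 'I_d * 'I_D) : K :=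
  (R (val il.1, val il.2, val j.1.1))`_j.1.2`_j.2.
have [|C [[[i0 l0] C0] CA]] := @linear_system _ _ _ A.
  by rewrite !card_prod !card_ord.
pose C' i l := if insub i is Some i' then if insub l is Some l' then C (i', l') else 0 else 0.
have C'E (i : 'I_(m.+1 * d)) (l : 'I_(L * d)) : C' i l = C (i, l) by rewrite /C' !valK.
exists C'; split; first by exists i0, l0; rewrite C'E.
move=> x y z Gx Gz zx.
have rem0 r : (r < d.-1)%N -> \sum_il (C il)%:P%:P * R (val il.1, val il.2, r) = 0.
  move=> ltr; apply/polyP => j; apply/polyP => k; rewrite !coef0 !coef_sum.
  have [lejd|ltj] := leqP d j.
    rewrite big1 // => -[i l] _; rewrite coefCM [X in _ * X]nth_default ?mulr0 ?coef0 //.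
    by have [_ sR _] := RP (val i, val l, r) (ltn_ord i) (ltn_ord l); apply: leq_trans lejd.
  have [leDk|ltk] := leqP D k.
    rewrite big1 // => -[i l] _; rewrite !coefCM [X in _ * X]nth_default ?mulr0 //.
    by have [_ _ sR] := RP (val i, val l, r) (ltn_ord i) (ltn_ord l); apply: leq_trans leDk.
  rewrite -[RHS](CA (Ordinal ltr, Ordinal ltj, Ordinal ltk)).
  by apply: eq_bigr => -[i l] _; rewrite !coefCM.
pose w (il : 'I_(m.+1 * d) * 'I_(L * d)) :=
  C il * (monom il.1).[x, y] ^+ M * y ^+ (il.2 %/ d).
pose h r := (drop_poly r.+1 (fiber y G)).[x].
have sE r r' : (s r r').[x, y] = (r == r')%:R - (r == d.-1)%:R * h r'.
  rewrite -fiber_horner /fiber /s rmorphB rmorphM !rmorph_nat /= !hornerE.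
  rewrite -!polyC_natr !hornerC; congr (_ - _ * _.[_]).
  by apply/polyP => i; rewrite coef_map !coef_drop_poly coef_map.
(* for r = d - 1 the equation is trivial, as h r = 1 *)
have key r : (r < d)%N ->
    \sum_il w il * (((il.2 %% d)%N == r)%:R - ((il.2 %% d)%N == d.-1)%:R * h r) = 0.
  move=> ltr; have [ltr'|ler] := ltnP r d.-1; last first.
    have rE : r = d.-1 by apply/eqP; rewrite eqn_leq ler andbT -ltnS prednK.
    have h1 : h r = 1.
      rewrite /h rE prednK // drop_poly_horner drop_poly_eq0.
        rewrite horner0 mulr0 addr0 coef_map /= /horner_eval.
        by have := monicP mG; rewrite lead_coefE sG /= => ->; rewrite hornerC.
      by rewrite (leq_trans (size_poly _ _)) // sG.
    by rewrite big1 // => il _; rewrite h1 mulr1 -rE subrr mulr0.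
  have := congr1 (fun P : {poly {poly K}} => P.[x, y]) (rem0 r ltr').
  rewrite /= !horner_sum !horner0 => E; rewrite -[RHS]E; apply: eq_bigr => -[i l] _ /=.
  have [[q E'] _ _] := RP (val i, val l, r) (ltn_ord i) (ltn_ord l).
  rewrite !hornerM !hornerC.
  have -> : (R (val i, val l, r)).[x, y] = (B i l r).[x, y].
    by rewrite E' !hornerD !hornerM Gx mulr0 add0r.
  rewrite /B hornerM hornerM sE horner_monomXY /w /monom horner_monomXY exprMn -!exprM exprD.
  by rewrite !mulrA [C _ * _ * _ * _]mulrAC.
have hz : \sum_(r < d) h r * z ^+ r = 0.
  have zx0 : z - x != 0 by rewrite subr_eq0.
  apply: (mulIf zx0); rewrite mul0r difference_quotient; last by rewrite -sG size_poly.
  by rewrite !fiber_horner Gx Gz subrr.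
transitivity (\sum_il w il * z ^+ (il.2 %% d)).
  rewrite pair_bigA; apply: eq_bigr => -[i l] _ /=.
  by rewrite C'E /w /= mulrA.
transitivity (\sum_(r < d) z ^+ r * \sum_il
    w il * (((il.2 %% d)%N == r)%:R - ((il.2 %% d)%N == d.-1)%:R * h r)); last first.
  by rewrite big1 // => r _; rewrite key ?mulr0.
under [RHS]eq_bigr do rewrite mulr_sumr.
rewrite exchange_big /=; apply: eq_bigr => il _.
transitivity (w il * (\sum_(r < d) ((il.2 %% d)%N == r)%:R * z ^+ r
   - ((il.2 %% d)%N == d.-1)%:R * \sum_(r < d) h r * z ^+ r)).
  rewrite hz mulr0 subr0 (bigD1 (Ordinal (ltn_pmod il.2 d_gt0))) //= eqxx mul1r.
  rewrite big1 ?addr0 // => r; rewrite -val_eqE /= eq_sym => /negPf ->.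
  by rewrite mul0r.
rewrite mulr_sumr -sumrB mulr_sumr; apply: eq_bigr => r _.
by ring.
Qed.

End Stepanov.

(** * Rational points on absolutely irreducible curves *)

(** Up to lower order terms there are at most (d - 1) d M (m + 1 + (d - 1) e)
    equations for d ^ 2 (m + 1) (M - eta) unknowns.  Hence M - eta can be as
    small as M (1 - 1/(2d)) as soon as m is large with respect to d and e. *)
Lemma more_unknowns d e M eta m :
  m = (2 * d * (1 + d * e))%N -> (0 < d)%N -> (0 < M)%N -> (e <= M)%N ->
  (2 * d * eta <= M)%N ->
  (d.-1 * d * (m * M + (M - eta) + e + d.-1 * M * e) < m.+1 * d * ((M - eta) * d))%N.
Proof.
case: d => // d mE _ M0 eM etaM /=.
set L := (M - eta)%N; have LM : (L <= M)%N by rewrite leq_subr.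
have L2 : ((2 * d + 1) * M <= 2 * d.+1 * L)%N by rewrite /L; nia.
rewrite [X in (X < _)%N](_ : _ = d.+1 * (d * (m * M + L + e + d * M * e)))%N; last by ring.
rewrite [X in (_ < X)%N](_ : _ = d.+1 * (m.+1 * (L * d.+1)))%N; last by ring.
rewrite ltn_pmul2l //.
have H1 : (d * (m * M + L + e + d * M * e) <= d * (M * (m + 2 + d * e)))%N.
  by rewrite leq_mul2l; nia.
have H2 : (m.+1 * ((2 * d + 1) * M) <= 2 * (m.+1 * (L * d.+1)))%N.
  rewrite [X in (_ <= X)%N](_ : _ = m.+1 * (2 * d.+1 * L))%N; last by ring.
  by rewrite leq_mul2l L2 orbT.
have H3 : (2 * (d * (M * (m + 2 + d * e))) < m.+1 * ((2 * d + 1) * M))%N.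
  rewrite [X in (X < _)%N](_ : _ = 2 * (d * (m + 2 + d * e)) * M)%N; last by ring.
  rewrite [X in (_ < X)%N](_ : _ = m.+1 * (2 * d + 1) * M)%N; last by ring.
  by rewrite ltn_pmul2r // mE; nia.
lia.
Qed.

(** The left-hand side bounds the number of coefficients in y of the reduced
    auxiliary polynomial, plus the number z of excluded fibers. *)
Lemma fewer_roots d e M eta Q m z :
  (0 < Q)%N -> (eta < M)%N -> (m + 1 + d * e + z <= eta)%N ->
  (m + (M - eta).-1 * Q + 1 + d * Q * e + z <= M * Q)%N.
Proof.
move=> Q0 etaM mz; have -> : M = ((M - eta).-1 + eta.+1)%N by lia.
move: (M - eta).-1 => k; nia.
Qed.

Lemma degree_slack d Q : (0 < d)%N -> (d.-1 + d.-1 * Q + 1 <= d + d * Q)%N.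
Proof. by case: d => // d _ /=; nia. Qed.

Section PointsMonic.
Variables (p : nat) (K : closedFieldType) (iota : {rmorphism 'F_p -> K}).
Hypothesis p_pr : prime p.
Let chK := pcharK iota p_pr.

(** Suppose that for all y in the field with p ^ (t * n) elements, apart from
    at most z of them, the roots x of G(.,y) are distinct and not in that field.
    Then x and its Frobenius image are distinct roots, so the auxiliary
    polynomial Psi vanishes at all the points above y.  Its remainder r modulo G
    then has more zeros in y than its degree allows; so G divides Psi, against
    [frobenius_independence]. *)
Lemma points_monic t d (G : {poly {poly K}}) (Z : seq K) :
  (0 < t)%N -> (0 < d)%N -> G \is monic -> size G = d.+1 ->
  irreducible_generic G -> G^`() != 0 -> frobXY chK t G = G ->
  exists n0, forall n, (n0 <= n)%N -> exists x y,
    [/\ Fpn K p (t * n) x, Fpn K p (t * n) y, G.[x, y] = 0 & y \notin Z].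
Proof.
move=> t0 d0 mG sG irr dG0 Gt.
have [rho rho0 rhoP] := separable_fibers mG irr dG0.
have [s1 s1P] := roots_seq rho0.
pose z := size (Z ++ s1); pose e := sizeY G.
have Ge i : (size (G`_i)%R <= e.+1)%N by apply/leqW/max_size_coefXY.
pose m := (2 * d * (1 + d * e))%N.
have sG1 : (1 < size G)%N by rewrite sG.
have [k kP] := frobenius_independence chK mG sG1 irr
  (fun c => @monom_independent K d G d0 mG sG (m.+1 * d) c).
pose eta0 := (m + 1 + d * e + z)%N.
(* eta0 is the value of eta from which [fewer_roots] applies, and this bound on
   n makes M = p ^ (t * n - k) so large that M %/ (2 * d) reaches it *)
exists (k + (2 * d * eta0 + e).+1)%N => n len.
have lenN : (n <= t * n)%N by rewrite leq_pmull.
pose N := (t * n)%N; pose M := (p ^ (N - k))%N; pose Q := (p ^ k)%N.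
have kN : (k <= N)%N by rewrite (leq_trans _ lenN) // (leq_trans _ len) // leq_addr.
have MQ : (M * Q)%N = (p ^ N)%N by rewrite /M /Q -expnD subnK.
have QM : (Q * M)%N = (p ^ N)%N by rewrite mulnC.
have Q0 : (0 < Q)%N by rewrite expn_gt0 prime_gt0.
have ltM : (2 * d * eta0 + e < M)%N.
  apply: leq_trans (ltnW (ltn_expl _ (prime_gt1 p_pr))); rewrite /N; lia.
pose eta := (M %/ (2 * d))%N; pose L := (M - eta)%N.
have d20 : (0 < 2 * d)%N by rewrite muln_gt0.
have etaM : (2 * d * eta <= M)%N by rewrite mulnC leq_trunc_div.
have eta0P : (eta0 <= eta)%N.
  by rewrite leq_divRL // mulnC (leq_trans _ (ltnW ltM)) // leq_addr.
have M0 : (0 < M)%N by apply: leq_ltn_trans ltM.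
have eM : (e <= M)%N by apply: leq_trans (ltnW ltM); apply: leq_addl.
have etaltM : (eta < M)%N.
  have: (2 * eta <= 2 * d * eta)%N by rewrite leq_mul2r leq_pmulr ?orbT.
  lia.
have [C [[i0 [l0 [lti0 ltl0 C0]]] Crel]] :=
  auxiliary_coefficients d0 mG sG Ge (more_unknowns (erefl m) d0 M0 eM etaM).
apply: contrapT => nopt.
have N0 : (0 < N)%N.
  exact: leq_trans (ltn0Sn _) (leq_trans (leq_trans (leq_addl _ _) len) lenN).
have [s [Us ss sP]] := Fpn_seq iota p_pr N0.
pose B := [seq y <- s | y \notin Z ++ s1].
have sB : (p ^ N <= size B + z)%N.
  rewrite -ss -(count_predC (mem (Z ++ s1)) s) addnC size_filter leq_add2l -size_filter.
  apply: uniq_leq_size; first exact: filter_uniq.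
  by move=> y; rewrite mem_filter => /andP[].
have /choice[c cE] : forall il : nat * nat, exists c : K, c ^+ (p ^ N) = C il.1 il.2.
  by move=> il; have [c cE] := frob_surj chK N (C il.1 il.2); exists c.
pose W i : {poly {poly K}} := \sum_(l < L * d) (c (i, val l))%:P%:P * monom K d l.
(* c is a p ^ N-th root of C, as Psi is raised to the power M and W to Q *)
pose Psi := \sum_(i < m.+1 * d) W i ^+ Q * monom K d i.
have chP : p \in [pchar {poly {poly K}}] by rewrite !pchar_poly.
have PsiE : Psi = \sum_(i < m.+1 * d) \sum_(l < L * d)
    monomXY K (i %/ d + l %/ d * Q) (i %% d + l %% d * Q) * (c (val i, val l) ^+ Q)%:P%:P.
  apply: eq_bigr => i _; rewrite (frob_sum chP) mulr_suml; apply: eq_bigr => l _.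
  rewrite exprMn -!polyC_exp /monom monomXY_exp -mulrA [X in _ = X]mulrC; congr (_ * _).
  by rewrite monomXY_mul addnC [X in monomXY _ _ X]addnC.
have divm i : (i < m.+1 * d)%N -> (i %/ d <= m)%N by move=> lti; rewrite -ltnS ltn_divLR.
have divL l : (l < L * d)%N -> (l %/ d <= L.-1)%N.
  move=> ltl; rewrite -ltnS prednK ?ltn_divLR //.
  by case: (L) ltl; rewrite ?mul0n.
have modd i : (i %% d <= d.-1)%N by rewrite -ltnS prednK ?ltn_pmod.
have sPsi : (size Psi <= d + d * Q)%N.
  rewrite PsiE; apply: (leq_trans (size_sum _ _ _)); apply/bigmax_leqP => i _.
  apply: (leq_trans (size_sum _ _ _)); apply/bigmax_leqP => l _.
  apply: leq_trans (size_monomXY_mul _ _ _) _.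
  have := size_polyC_leq1 (c (val i, val l) ^+ Q)%:P => s1'.
  apply: (@leq_trans (d.-1 + d.-1 * Q + 1)); last exact: degree_slack.
  by rewrite !leq_add ?leq_mul2r ?modd ?orbT.
have PsiD j : (size (Psi`_j)%R <= m + L.-1 * Q + 1)%N.
  rewrite PsiE coef_sum; apply: (leq_trans (size_sum _ _ _)); apply/bigmax_leqP => i _.
  rewrite coef_sum; apply: (leq_trans (size_sum _ _ _)); apply/bigmax_leqP => l _.
  apply: leq_trans (@size_coef_monomXY_mul _ _ _ _ 1 _ _) _.
    move=> j'; rewrite coefC; case: ifP => _; last by rewrite size_poly0.
    exact: size_polyC_leq1.
  by rewrite !leq_add ?leq_mul2r ?divm ?divL ?orbT.
have [q [r [PsiqE sr rD]]] := monic_division mG sG Ge sPsi PsiD.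
have Gpt x y : Fpn K p N x -> Fpn K p N y -> G.[x, y] = 0 -> y \in Z.
  by move=> xN yN G0; apply: contrapT => /negP yZ; apply: nopt; exists x, y.
(* Psi ^ M is the sum of auxiliary_coefficients with z := x ^ (p ^ N) *)
have Psi0 x y : y \in B -> G.[x, y] = 0 -> Psi.[x, y] = 0.
  rewrite mem_filter mem_cat negb_or -andbA => /and3P[yZ _ /sP yN] Gx.
  pose x' := x ^+ (p ^ N).
  have Gx' : G.[x', y] = 0.
    have := frobXY_eval chK N G x y; rewrite (frobXY_dvd Gt (dvdn_mulr n (dvdnn t))) Gx yN => ->.
    exact: (rmorph0 (frob _ chK)).
  have xx' : x' != x by apply: contraNneq yZ => xN; apply: Gpt Gx.
  have := Crel x y x' Gx Gx' xx' => E.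
  have : Psi.[x, y] ^+ M = 0.
    rewrite /M (horner2_sum) (frob_sum chK) -[RHS]E; apply: eq_bigr => i _.
    rewrite hornerM hornerM exprMn horner2_exp -exprM -/M QM horner2_sum (frob_sum chK).
    rewrite mulr_suml; apply: eq_bigr => l _.
    rewrite hornerM hornerM !hornerC exprMn cE /= {1}/monom horner_monomXY exprMn.
    rewrite -!exprM ![(_ * p ^ N)%N]mulnC !exprM yN -/x'.
    by rewrite mulrAC.
  by move/eqP; rewrite expf_eq0 M0 => /eqP.
have r0 : r = 0.
  apply/polyP => j; rewrite coef0; apply: contrapT => /eqP rj0.
  have Broots : all (root r`_j) B.
    apply/allP => y yB.
    have [rs Urs rsE] : exists2 rs, uniq rs & fiber y G = \prod_(r <- rs) ('X - r%:P).
      apply: rhoP; apply: contraTneq yB => ry0.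
      by rewrite mem_filter mem_cat (s1P _ ry0) orbT.
    have szrs : size rs = d.
      apply: succn_inj; transitivity (size (fiber y G)); first by rewrite rsE size_prod_XsubC.
      by rewrite /fiber size_map_poly_id0 ?sG // (monicP mG) /= /horner_eval hornerC oner_neq0.
    have fr0 : fiber y r = 0.
      apply: contrapT => /eqP fr0; have : all (root (fiber y r)) rs.
        apply/allP => x xrs; have Gx : G.[x, y] = 0.
          by rewrite -fiber_horner rsE; apply/rootP; rewrite root_prod_XsubC.
        apply/rootP; rewrite fiber_horner.
        by have := Psi0 x y yB Gx; rewrite PsiqE !hornerD !hornerM Gx mulr0 add0r.
      move/(max_poly_roots fr0)/(_ Urs); rewrite szrs ltnNge.
      by rewrite (leq_trans (size_poly _ _)).
    by have := congr1 (fun f : {poly K} => f`_j) fr0; rewrite coef_map coef0 => /rootP.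
  have := max_poly_roots rj0 Broots (filter_uniq _ Us).
  rewrite ltnNge => /negP; apply; apply: leq_trans (rD j) _.
  rewrite -(leq_add2r z); apply: leq_trans sB; rewrite -MQ; exact: fewer_roots.
have /kP W0 : dvdXY G Psi by exists q; rewrite PsiqE r0 addr0.
have c0 : c (i0, l0) = 0.
  exact: (@monom_independent K d G d0 mG sG _ (fun l => c (i0, l)) (W0 i0 lti0) l0 ltl0).
case/eqP: C0; have := cE (i0, l0); rewrite c0 /= => <-.
exact: (rmorph0 (frob _ chK)).
Qed.

End PointsMonic.

Section Monicization.
Variables (K : closedFieldType) (d : nat) (G : {poly {poly K}}).
Hypotheses (d_gt0 : (0 < d)%N) (sG : size G = d.+1).

Let a := lead_coef G.

(** The monic polynomial a ^ (d - 1) G(x / a, y), whose roots are those of G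
    multiplied by the leading coefficient a. *)
Definition monicized : {poly {poly K}} :=
  'X^d + \poly_(i < d) (a ^+ (d.-1 - i) * G`_i).

Lemma coef_monicized_scaled i : monicized`_i * a ^+ i = a ^+ d.-1 * G`_i.
Proof.
rewrite coefD coefXn coef_poly; case: ltngtP => [lti|ltd|->].
- by rewrite add0r mulrAC -exprD subnK // -ltnS prednK.
- by rewrite addr0 mul0r [G`__]nth_default ?mulr0 ?sG.
- have -> : G`_d = a by rewrite /a lead_coefE sG.
  by rewrite addr0 mul1r -exprSr prednK.
Qed.

Lemma size_monicized : size monicized = d.+1.
Proof. by rewrite size_polyDl size_polyXn // ltnS size_poly. Qed.

Lemma monicized_monic : monicized \is monic.
Proof. by rewrite monicE lead_coefDl ?lead_coefXn // size_polyXn ltnS size_poly. Qed.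

Lemma leading_neq0 : a != 0.
Proof. by rewrite lead_coef_eq0 -size_poly_gt0 sG. Qed.

Lemma monicized_scaled : monicized \Po (a *: 'X) = a ^+ d.-1 *: G.
Proof.
apply/polyP => i; rewrite coefZ -coef_monicized_scaled comp_polyE coef_sum.
under eq_bigr do rewrite exprZn !coefZ coefXn.
have [lti|lei] := ltnP i (size monicized).
  rewrite (bigD1 (Ordinal lti)) //= eqxx mulr1 big1 ?addr0 // => j.
  by rewrite -val_eqE eq_sym /= => /negPf ->; rewrite !mulr0.
rewrite [monicized`_i]nth_default // mul0r big1 // => j _.
by rewrite (gtn_eqF (leq_trans (ltn_ord j) lei)) !mulr0.
Qed.

Lemma monicized_irreducible : irreducible_generic G -> irreducible_generic monicized.
Proof.
move=> irr c A B c0 E.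
have aX : size (a *: 'X : {poly {poly K}}) = 2%N by rewrite size_scale ?leading_neq0 ?size_polyX.
have := irr (c * a ^+ d.-1) (A \Po (a *: 'X)) (B \Po (a *: 'X)).
rewrite mulf_neq0 ?expf_neq0 ?leading_neq0 // !size_comp_poly2 //; apply=> //.
by rewrite -scalerA -monicized_scaled -comp_polyZ E comp_polyM.
Qed.

Lemma monicized_separable : G^`() != 0 -> monicized^`() != 0.
Proof.
apply: contraNneq => dm0; have := deriv_comp monicized (a *: 'X).
rewrite dm0 comp_poly0 mul0r monicized_scaled derivZ => /eqP.
by rewrite -mul_polyC mulf_eq0 polyC_eq0 expf_eq0 (negPf leading_neq0) andbF.
Qed.

Lemma monicized_zero x y : a.[y] != 0 -> monicized.[a.[y] * x, y] = 0 -> G.[x, y] = 0.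
Proof.
move=> ay E; apply: (mulfI (expf_neq0 d.-1 ay)); rewrite mulr0 -[RHS]E -!fiber_horner.
rewrite (@horner_coef_wide _ d.+1 (fiber y G)) ?(leq_trans (size_poly _ _)) ?sG //.
rewrite (@horner_coef_wide _ d.+1 (fiber y monicized)); last first.
  by rewrite (leq_trans (size_poly _ _)) ?size_monicized.
rewrite mulr_sumr; apply: eq_bigr => i _; rewrite !coef_map exprMn !mulrA; congr (_ * _).
have := congr1 (fun c : {poly K} => c.[y]) (coef_monicized_scaled i).
by rewrite /= !hornerM !horner_exp.
Qed.

End Monicization.

Section Points.
Variables (p : nat) (K : closedFieldType) (iota : {rmorphism 'F_p -> K}).
Hypothesis p_pr : prime p.
Let chK := pcharK iota p_pr.

Lemma points_inner t (G : {poly {poly K}}) (Z : seq K) :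
  (0 < t)%N -> irreducibleXY G -> dx G != 0 -> frobXY chK t G = G ->
  exists n0, forall n, (n0 <= n)%N -> exists x y,
    [/\ Fpn K p (t * n) x, Fpn K p (t * n) y, G.[x, y] = 0 & y \notin Z].
Proof.
move=> t0 irrG dG0 Gt; have sG1 : (1 < size G)%N.
  by rewrite ltnNge; apply: contra dG0 => /size1_polyC GE; rewrite /dx GE derivC.
have [d [d0 sG]] : exists d, (0 < d)%N /\ size G = d.+1.
  by exists (size G).-1; rewrite prednK ?(ltnW sG1) // -ltnS prednK ?(ltnW sG1).
have irr : irreducible_generic G by move=> c A B; apply: irreducible_pseudo.
set a := lead_coef G; have a0 : a != 0 := leading_neq0 sG.
pose f := map_poly (frob t chK).
have fG i : f G`_i = G`_i by rewrite -{2}Gt coef_map.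
have fa : f a = a by rewrite /a lead_coefE fG.
have mt : frobXY chK t (monicized d G) = monicized d G.
  have fD u v : f (u + v) = f u + f v by apply: rmorphD.
  have fM u v : f (u * v) = f u * f v by apply: rmorphM.
  have fX u k : f (u ^+ k) = f u ^+ k by apply: rmorphXn.
  have fN k : f k%:R = k%:R by apply: rmorph_nat.
  have f0 : f 0 = 0 by apply: rmorph0.
  apply/polyP => i; rewrite coef_map -[LHS]/(f _) coefD coefXn coef_poly fD fN.
  by case: ifP => _; rewrite ?f0 // fM fX fG fa.
have [s sP] := roots_seq a0.
have [n0 n0P] := points_monic (Z ++ s) t0 d0 (monicized_monic d G)
  (size_monicized d G) (monicized_irreducible d0 sG irr) (monicized_separable d0 sG dG0) mt.
exists n0 => n /n0P[x [y [xN yN mxy]]]; rewrite mem_cat negb_or => /andP[yZ ys].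
have ay : a.[y] != 0 by apply: contraNneq ys; apply: sP.
exists (x / a.[y]), y; split=> //; last first.
  apply: (monicized_zero d0 sG ay).
  by rewrite mulrC divfK.
have aP : frobXY chK t a%:P = a%:P by rewrite /frobXY map_polyC -/f /= -[map_poly _ _]/(f a) fa.
have := frobXY_eval chK (t * n) a%:P x y.
rewrite (frobXY_dvd aP (dvdn_mulr n (dvdnn t))) !hornerC yN => aN.
by rewrite /Fpn /= exprMn exprVn xN -aN.
Qed.

Lemma frobXY_swap n (G : {poly {poly K}}) : frobXY chK n (swapXY G) = swapXY (frobXY chK n G).
Proof.
by apply/polyP => i; apply/polyP => j; rewrite coef_frobXY !coef_swapXY coef_frobXY.
Qed.

(** The coordinates are exchanged if G is inseparable in x; it is then separable
    in y. *)
Lemma many_points t (G : {poly {poly K}}) (Z : seq K) :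
  (0 < t)%N -> irreducibleXY G -> frobXY chK t G = G ->
  exists n0, forall n, (n0 <= n)%N -> exists x y,
    [/\ Fpn K p (t * n) x, Fpn K p (t * n) y, G.[x, y] = 0 & (x \notin Z) || (y \notin Z)].
Proof.
move=> t0 irr Gt; have [dx0|dy0] := irreducible_deriv chK irr.
  have [n0 n0P] := points_inner Z t0 irr dx0 Gt.
  by exists n0 => n /n0P[x [y [xN yN Gxy yZ]]]; exists x, y; rewrite yZ orbT.
have [|n0 n0P] := points_inner Z t0 (swapXY_irreducible irr) _
    (etrans (frobXY_swap t G) (congr1 _ Gt)).
  by rewrite -swapXY_dy; apply: swapXY_neq0.
exists n0 => n /n0P[y [x [yN xN]]]; rewrite horner2_swapXY => Gxy xZ.
by exists x, y; rewrite xZ.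
Qed.

End Points.

(** * The equivalence *)

Theorem theorem3p13 (p : nat) (p_pr : prime p)
    (K : closedFieldType) (iota : {rmorphism 'F_p -> K})
    (K_closure : algebraic_closure iota)
    (t : nat) (t_gt0 : (0 < t)%N)
    (h : {poly {poly K}}) (h_Fq : defined_over (Fpn K p t) h) (h_neq0 : h != 0) :
  let r := gcdn t (N p h) in
  (* F_{q ^ n} = F_{p ^ (t * n)} *)
  let good (s : nat) : set nat :=
    [set n | (0 < n)%N /\ V h (Fpn K p (t * n)) `<=` A2 (Fpn K p s)] in
  [<-> ~ (exists g : {poly {poly K}},
            [/\ defined_over (Fpn K p t) g, divides_over (Fpn K p t) g h &
                irreducibleXY g]);
       forall s : nat, (0 < s)%N -> (r %| s)%N -> infinite_set (good s);
       infinite_set (good r);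
       exists s : nat, [/\ (0 < s)%N, (r %| s)%N & infinite_set (good s)]].
Proof.
move=> r good; have chK := pcharK iota p_pr.
have r0 : (0 < r)%N by rewrite gcdn_gt0 t_gt0.
have ht : frobXY chK t h = h by apply/frobXYP.
tfae.
- move=> noabs s s0 rs; apply: infinitely_many_good => //.
  by move=> z; apply: (algebraic_in_Fpn chK (K_closure z)).
- by apply=> //; rewrite dvdnn.
- by move=> inf; exists r; split.
move=> [s [s0 _ /infinite_natP inf]] [g [gt [k _ hE] irr]].
have [Z [_ _ ZP]] := Fpn_seq iota p_pr s0.
have gt' : frobXY (pcharK iota p_pr) t g = g by apply/frobXYP.
have [n0 n0P] := many_points Z t_gt0 irr gt'.
have [n /n0P[x [y [xN yN gxy xyZ]]] [n_gt0 sub]] := inf n0.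
have /sub[/= xs ys] : V h (Fpn K p (t * n)) (x, y).
  by split=> //=; rewrite hE !hornerM gxy mulr0.
by move: xyZ; rewrite (proj2 (ZP x) xs) (proj2 (ZP y) ys).
Qed.
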